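(* $$\sum_{n=-\infty}^{\infty}\sum_{m=-\infty}^{\infty}\frac{(-1)^{m+n}}{(5m)^2+(5n+1)^2}=-\frac{\pi}{5\sqrt{5}}\log\left(\sqrt{5}+1-\sqrt{5+2\sqrt{5}}\right)+\frac{\pi}{25}\log\left(11+5\sqrt{5}\right).$$
   Context: The double series is not absolutely convergent. It is interpreted as $\lim_{N\to\infty}\sum_{-N<n<N}\left(\sum_{m\in\mathbb{Z}}\frac{(-1)^{m+n}}{(5m)^2+(5n+1)^2}\right)$, where for each fixed $n$ the inner sum over $m\in\mathbb{Z}$ converges absolutely. The logarithms are real logarithms of positive real numbers. *)

(* Defs.v *)
From Stdlib Require Import Reals ZArith.
From Coquelicot Require Import Coquelicot.

Open Scope R_scope.

(* Sums over Z are split as k = 0, 1, 2, ... and k = -1, -2, -3, ... *)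

Definition ex_Zseries_abs (f : Z -> R) : Prop :=
  ex_series (fun k : nat => Rabs (f (Z.of_nat k))) /\
  ex_series (fun k : nat => Rabs (f (- Z.of_nat (S k))%Z)).

(* Meaningful under [ex_Zseries_abs f], since [Series] is total. *)
Definition Zseries (f : Z -> R) : R :=
  Series (fun k : nat => f (Z.of_nat k)) +
  Series (fun k : nat => f (- Z.of_nat (S k))%Z).

(* Sum of [f n] over -N < n < N, with n = k - N and 1 <= k <= 2N - 1
   (an empty range for N = 0). *)
Definition Zsum_sym (f : Z -> R) (N : nat) : R :=
  sum_n_m (fun k : nat => f (Z.of_nat k - Z.of_nat N)%Z) 1 (2 * N - 1).

Definition term (m n : Z) : R :=
  powerRZ (-1) (m + n) / ((5 * IZR m) ^ 2 + (5 * IZR n + 1) ^ 2).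

(* Main.v *)
(* Attach to (m, n) the Gaussian integer z = 5m + (5n+1)i; the summand depends only on k = |z|^2, it is
   -(-1)^k / k.  The unit rotations of the class of i modulo 5 make up exactly the z with
   |z|^2 = 1 mod 5, so the sum over disks is a sum over k = 1 mod 5 of -(-1)^k r_2(k) / (4 k).  Jacobi's formula
   r_2(k) = 4 sum_(d | k) chi_4(d), obtained here from the Hecke relation at each prime, turns it into a sum over
   pairs d e = 1 mod 5 of chi_4(d) (-1)^e / (d e).  The indicator of d e = 1 mod 5 is a combination of products
   f(d) g(e), and by Dirichlet's hyperbola method each piece tends to a product of two series of the form
   sum cos(d t)/d or sum sin(d t)/d.  Finally, summing by rows or by disks differs by O(1/N), because the rows
   are alternating series. *)
From HB Require Import structures.
From Stdlib Require Import Reals ZArith Lra Lia.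
From mathcomp Require Import all_boot ssrZ zify cyclic.
From Coquelicot Require Import Coquelicot.
Require Import Defs.

Set Implicit Arguments.
Unset Strict Implicit.

(* ssralg has bound the key R to ring_scope. *)
Delimit Scope R_scope with R.
Local Open Scope nat_scope.

(** All convergence here is conditional, so convergence of the factor series alone does not control
    the products. The hyperbola method is run with partial sums within O(1/N) of their limits; the
    trigonometric series get this rate by differentiating in the angle and comparing with the angle
    [PI]. The cutoff is always a square Y^2, so that the two halves of the hyperbola meet at Y; the
    disks matched with the rows have integer radius, so a limit along squares is enough. The residue
    functions modulo 5 are real and either even or odd. Multiplied by chi_4, which is odd, an even
    one gives sine series (multiples of pi) and an odd one gives cosine series (logarithms).
    Multiplied by (-1)^e, which is even, the roles are exchanged. Hence each of the four products is
    pi times a combination of logarithms, which is the shape of the answer. The Hecke relation for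
    r_2 is obtained by counting, without unique factorisation in Z[i]; for p = 1 mod 4 the element
    of norm p comes from Zagier's involution. *)

HB.instance Definition _ := Monoid.isComLaw.Build R R0 Rplus
  (fun x y z => esym (Rplus_assoc x y z)) Rplus_comm Rplus_0_l.
HB.instance Definition _ := Monoid.isMulLaw.Build R R0 Rmult Rmult_0_l Rmult_0_r.
HB.instance Definition _ := Monoid.isAddLaw.Build R Rmult Rplus
  Rmult_plus_distr_r Rmult_plus_distr_l.

(* [ring] does not see through the canonical [eqType] on [Z]. *)
Ltac zring := match goal with |- @eq _ ?a ?b => change (@eq Z a b); ring end.

Ltac zmlia := zify; Z.to_euclidean_division_equations; lia.

(** * Two squares *)

(** The points moved by [f] come in pairs: [f] exchanges those whose code decreases with those whose
    code increases. [pickle] only serves to order [T]. *)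
Lemma size_involution_odd (T : countType) (f : T -> T) (s : seq T) :
  uniq s -> {in s, forall x, f x \in s} -> {in s, involutive f} ->
  odd (size s) = odd (count (fun x => f x == x) s).
Proof.
move=> Us fs fK.
pose lt := fun x => pickle (f x) < pickle x.
pose gt := fun x => pickle x < pickle (f x).
have E : perm_eq [seq f x | x <- s & lt x] [seq x <- s | gt x].
  apply: uniq_perm; last 1 first.
  - move=> y; rewrite mem_filter; apply/mapP/andP.
      case=> x; rewrite mem_filter => /andP[lx xs] ->; split; last exact: fs.
      by rewrite /gt fK.
    case=> gy ys; exists (f y); last by rewrite fK.
    by rewrite mem_filter /lt fK // fs // andbT.
  - rewrite map_inj_in_uniq ?filter_uniq // => x y; rewrite !mem_filter.
    by move=> /andP[_ xs] /andP[_ ys] /(congr1 f); rewrite !fK.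
  - exact: filter_uniq.
have {E} := perm_size E; rewrite size_map !size_filter => E.
have -> : size s = count lt s + count gt s + count (fun x => f x == x) s.
  rewrite -(count_predC (fun x => f x == x) s) addnC; congr addn.
  rewrite -[RHS]count_predUI [X in _ + X](_ : _ = 0) ?addn0.
    apply: eq_count => x /=; rewrite /lt /gt -neq_ltn.
    by rewrite (eqtype.inj_eq (pcan_inj (@pickleK T))).
  by apply/eqP; rewrite -leqn0 leqNgt -has_count; apply/hasPn=> x _ /=; rewrite /lt /gt; lia.
by rewrite E addnn oddD odd_double.
Qed.

(** The finite set of Zagier's one-sentence proof. Positivity bounds each coordinate by [p], so the
    box loses no solution. *)
Definition zagier_set (p : nat) : seq (nat * nat * nat) :=
  [seq t <- [seq (u, z) | u <- [seq (x, y) | x <- seq.iota 0 p.+1, y <- seq.iota 0 p.+1],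
                          z <- seq.iota 0 p.+1] |
    [&& t.1.1 * t.1.1 + 4 * t.1.2 * t.2 == p, 0 < t.1.1, 0 < t.1.2 & 0 < t.2]].

Lemma zagier_set_uniq p : uniq (zagier_set p).
Proof.
apply: filter_uniq; apply: allpairs_uniq; rewrite ?iota_uniq //; last by move=> [? ?] [? ?].
by apply: allpairs_uniq; rewrite ?iota_uniq // => -[? ?] [? ?].
Qed.

Lemma mem_zagier_set p x y z :
  ((x, y, z) \in zagier_set p) =
  [&& x * x + 4 * y * z == p, 0 < x, 0 < y & 0 < z].
Proof.
rewrite mem_filter [t in t && _]/=; case: and4P => // -[/eqP E x0 y0 z0].
rewrite andTb.
have xp : x < p.+1 by nia.
have yp : y < p.+1 by nia.
have zp : z < p.+1 by nia.
apply/allpairsP; exists ((x, y), z); split; rewrite ?mem_iota //.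
by apply/allpairsP; exists (x, y); split; rewrite ?mem_iota.
Qed.

Definition zagier_map (t : nat * nat * nat) : nat * nat * nat :=
  let: (x, y, z) := t in
  if x + z < y then (x + 2 * z, z, y - x - z)
  else if x < 2 * y then (2 * y - x, y, x + z - y)
  else (x - 2 * y, x + z - y, y).

Lemma prime_nsquare n : ~ prime (n * n).
Proof.
move=> P; have := prime_gt1 P; case/primeP: P => n1 H g1.
have /H : n %| n * n by rewrite dvdn_mulr.
by case/orP=> /eqP; nia.
Qed.

(** On the two walls between the regions p would be composite: y = x + z gives p = (y + z)^2, and x
    = 2y gives a multiple of 4. The outer cases name the difference [w], so that later computations
    avoid truncated subtraction. *)
Lemma zagier_cases p x y z : prime p -> (x, y, z) \in zagier_set p ->
  [\/ exists2 w, 0 < w & y = x + z + w,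
      x + z > y /\ x < 2 * y | exists2 w, 0 < w & x = 2 * y + w].
Proof.
move=> pP; rewrite mem_zagier_set => /and4P[/eqP E x0 y0 z0].
case: (ltngtP (x + z) y) => h1.
- by constructor 1; exists (y - x - z); lia.
- case: (ltngtP x (2 * y)) => h2; first by constructor 2.
    by constructor 3; exists (x - 2 * y); lia.
  case: (@prime_nsquare 2); move: pP; rewrite -E h2.
  rewrite (_ : _ + _ = 4 * (y * y + y * z)); last by lia.
  by case/primeP=> _ /(_ 2); rewrite -[4]/(2 * 2) -mulnA dvdn_mulr // => /(_ isT) /orP[//|/eqP]; nia.
- case: (@prime_nsquare (y + z)); move: pP; rewrite -E -h1.
  by congr prime; lia.
Qed.

(** The two outer regions are exchanged and the middle one is mapped to itself. *)
Lemma zagier_map_spec p x y z : prime p -> (x, y, z) \in zagier_set p ->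
  zagier_map (x, y, z) \in zagier_set p /\ zagier_map (zagier_map (x, y, z)) = (x, y, z).
Proof.
move=> pP S; have := S; rewrite mem_zagier_set => /and4P[/eqP E x0 y0 z0].
case: (zagier_cases pP S) => [[w w0 yE]|[h1 h2]|[w w0 xE]].
- have -> : zagier_map (x, y, z) = (x + 2 * z, z, w).
    by rewrite /zagier_map ifT; [congr (_, _, _)|]; lia.
  rewrite mem_zagier_set; split; first by apply/and4P; split; [apply/eqP; nia | lia..].
  by rewrite /zagier_map !ifF; [congr (_, _, _)|..]; lia.
- have [w wE] : exists w, x + z = y + w by exists (x + z - y); lia.
  have -> : zagier_map (x, y, z) = (2 * y - x, y, w).
    by rewrite /zagier_map ifF ?ifT; [congr (_, _, _)|..]; lia.
  have [v vE] : exists v, 2 * y = x + v by exists (2 * y - x); lia.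
  rewrite (_ : 2 * y - x = v); last by lia.
  rewrite mem_zagier_set; split; first by apply/and4P; split; [apply/eqP; nia | lia..].
  by rewrite /zagier_map ifF ?ifT; [congr (_, _, _)|..]; lia.
- have -> : zagier_map (x, y, z) = (w, w + y + z, y).
    by rewrite /zagier_map !ifF; [congr (_, _, _)|..]; lia.
  rewrite mem_zagier_set; split; first by apply/and4P; split; [apply/eqP; nia | lia..].
  by rewrite /zagier_map ifT; [congr (_, _, _)|..]; lia.
Qed.

(** A fixed point must lie in the middle region with x = y; then p = x (x + 4z) forces x = 1, and z
    = (p - 1) / 4 is an integer because p = 1 mod 4. *)
Lemma zagier_fixed p : prime p -> p %% 4 = 1 ->
  count (fun t => zagier_map t == t) (zagier_set p) = 1.
Proof.
move=> pP p4; pose t0 : nat * nat * nat := (1, 1, p %/ 4).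
have t0S : t0 \in zagier_set p.
  by rewrite mem_zagier_set; have := prime_gt1 pP; lia.
rewrite -(_ : count_mem t0 (zagier_set p) = 1); last by rewrite count_uniq_mem ?zagier_set_uniq // t0S.
have p1 := prime_gt1 pP.
apply: eq_in_count => t S; apply/eqP/eqP; last first.
  move=> ->; have -> : zagier_map t0 = (1, 1, 1 + p %/ 4 - 1); last by congr (_, _, _); lia.
  by [].
case: t S => [[x y] z] S; rewrite /zagier_map.
have := S; rewrite mem_zagier_set => /and4P[/eqP E x0 y0 z0].
case: (zagier_cases pP S) => [[w w0 yE]|[h1 h2]|[w w0 xE]].
- by rewrite ifT; [case|]; lia.
- rewrite ifF ?ifT; [|lia..]; case=> h3 _.
  have xy : x = y by lia.
  have : y %| p by rewrite -E xy -mulnA mulnCA -mulnDr dvdn_mulr.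
  case/primeP: pP => _ H /H /orP[] /eqP yE; first by congr (_, _, _); lia.
  by nia.
- by rewrite !ifF; [case| |]; lia.
Qed.

(** Zagier's involution shows that the set has odd size, so the swap of y and z also has a fixed
    point; there y = z and p = x^2 + (2y)^2. *)
Lemma prime_sum_two_squares p : prime p -> p %% 4 = 1 -> exists x y, x * x + y * y = p.
Proof.
move=> pP p4; pose sw (t : nat * nat * nat) := (t.1.1, t.2, t.1.2).
have odd1 : odd (size (zagier_set p)).
  rewrite (@size_involution_odd _ zagier_map) ?zagier_set_uniq ?zagier_fixed //.
    by move=> [[x y] z] /(zagier_map_spec pP)[].
  by move=> [[x y] z] /(zagier_map_spec pP)[].
have : odd (count (fun t => sw t == t) (zagier_set p)).
  rewrite -size_involution_odd ?zagier_set_uniq //.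
    move=> [[x y] z]; rewrite !mem_zagier_set => /and4P[/eqP E ? ? ?].
    by apply/and4P; split => //=; apply/eqP; lia.
  by move=> [[x y] z].
case E: (count _ _) => [//|n] _.
have : has (fun t => sw t == t) (zagier_set p) by rewrite has_count E.
case/hasP=> -[[x y] z]; rewrite mem_zagier_set => /and4P[/eqP <- _ _ _] /eqP[zy _].
by exists x, (2 * z); rewrite zy; lia.
Qed.

(** * Jacobi's two-square theorem *)

Definition sqnorm (z : Z * Z) : Z := (z.1 * z.1 + z.2 * z.2)%Z.

Definition zrange (M : nat) : seq Z :=
  [seq (Z.of_nat k - Z.of_nat M)%Z | k <- seq.iota 0 (2 * M).+1].

Definition rep (N : nat) : seq (Z * Z) :=
  [seq z <- [seq (a, b) | a <- zrange N, b <- zrange N] | sqnorm z == Z.of_nat N].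

Lemma zrange_uniq M : uniq (zrange M).
Proof. by rewrite map_inj_uniq ?iota_uniq // => a b; lia. Qed.

Lemma mem_zrange M a : (Z.abs a <= Z.of_nat M)%Z -> a \in zrange M.
Proof.
by move=> h; apply/mapP; exists (Z.to_nat (a + Z.of_nat M)); rewrite ?mem_iota; lia.
Qed.

Lemma rep_uniq N : uniq (rep N).
Proof.
by apply/filter_uniq/allpairs_uniq; rewrite ?zrange_uniq // => -[? ?] [? ?].
Qed.

Lemma mem_rep N z : (z \in rep N) = (sqnorm z == Z.of_nat N).
Proof.
rewrite mem_filter; case: eqP => //; case: z => a b E; rewrite andTb.
have {}E : (a * a + b * b)%Z = Z.of_nat N by [].
have aN : (Z.abs a <= Z.of_nat N)%Z by nia.
have bN : (Z.abs b <= Z.of_nat N)%Z by nia.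
by apply/allpairsP; exists (a, b); split; [exact: mem_zrange..|].
Qed.

(** The counting tool for multiplication in Z[i]: it is applied with [f] the multiplication by 1 +
    i, by p, by an element of norm p, and by i. *)
Lemma size_count_image (T : eqType) (f : T -> T) (P : pred T) (s t : seq T) :
  uniq s -> uniq t -> injective f ->
  (forall x, x \in s -> P (f x) && (f x \in t)) ->
  (forall y, y \in t -> P y -> exists2 x, x \in s & y = f x) ->
  size s = count P t.
Proof.
move=> Us Ut fI fst tfs; rewrite -(size_map f) -size_filter; apply: perm_size.
apply: uniq_perm; rewrite ?filter_uniq ?map_inj_uniq // => y.
rewrite mem_filter; apply/mapP/andP => [[x /fst/andP[? ?] ->] //|[Py yt]].
exact: tfs.
Qed.

Lemma prime_Zdvd_mul p (a b : Z) : prime p ->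
  (Z.of_nat p | a * b)%Z -> (Z.of_nat p | a)%Z \/ (Z.of_nat p | b)%Z.
Proof.
have dvdE c : (Z.of_nat p | c)%Z <-> p %| Z.abs_nat c.
  split=> [[k ->]|/dvdnP[k kE]]; first by apply/dvdnP; exists (Z.abs_nat k); lia.
  by case: (Z.abs_eq_or_opp c) => cE; [exists (Z.of_nat k)|exists (- Z.of_nat k)%Z]; lia.
move=> pP; rewrite !dvdE => h; apply/orP; rewrite -Euclid_dvdM //.
by move: h; congr (_ %| _); lia.
Qed.

Lemma prime_Zdvd_sqr p (a : Z) : prime p -> (Z.of_nat p | a * a)%Z -> (Z.of_nat p | a)%Z.
Proof. by move=> pP /(prime_Zdvd_mul pP)[]. Qed.

(** Multiplication by 1 + i is a bijection: if x^2 + y^2 is even then so is (x + y)^2, and the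
    quotient by 1 + i is integral. *)
Lemma size_rep_mul2 N : size (rep (2 * N)) = size (rep N).
Proof.
rewrite -(count_predT (rep (2 * N))); symmetry.
apply: (@size_count_image _ (fun z => (z.1 - z.2, z.1 + z.2)%Z)); rewrite ?rep_uniq //.
- by move=> [a b] [c d] [] /= ? ?; congr (_, _); lia.
- by move=> [a b]; rewrite !mem_rep /sqnorm /= => /eqP E; apply/eqP; nia.
move=> [x y]; rewrite mem_rep /sqnorm /= => /eqP E _.
have [k kE] : (Z.of_nat 2 | x + y)%Z.
  by apply: prime_Zdvd_sqr => //; exists (Z.of_nat N + x * y)%Z; nia.
have yE : y = (2 * k - x)%Z by lia.
exists (k, (k - x)%Z); last by rewrite /=; congr (_, _); lia.
by rewrite mem_rep /sqnorm /=; apply/eqP; nia.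
Qed.

(** The elements counted by [T] are exactly the multiples of p, and p z has norm p N when z has norm
    N / p. This serves the intersection term for p = 1 mod 4 and all representations for p = 3 mod
    4. *)
Lemma count_rep_prime_mul p N (T : pred (Z * Z)) : prime p ->
  (forall a b, T (Z.of_nat p * a, Z.of_nat p * b)%Z) ->
  (forall x y, (x, y) \in rep (p * N) -> T (x, y) ->
     (Z.of_nat p | x)%Z /\ (Z.of_nat p | y)%Z) ->
  count T (rep (p * N)) = if p %| N then size (rep (N %/ p)) else 0.
Proof.
move=> pP Tp Td; have p0 := prime_gt0 pP.
case: ifP => [/dvdnP[M NE]|pN].
  rewrite NE mulnK // -?NE; symmetry.
  apply: (@size_count_image _ (fun z => (Z.of_nat p * z.1, Z.of_nat p * z.2)%Z)); rewrite ?rep_uniq //.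
  - by move=> [a b] [c d] [] /= ? ?; congr (_, _); nia.
  - move=> [a b]; rewrite Tp !mem_rep /sqnorm /= => /eqP E; apply/eqP; nia.
  move=> [x y] S /(Td _ _ S)[[a aE] [b bE]]; exists (a, b); last by rewrite /=; congr (_, _); lia.
  by move: S; rewrite !mem_rep /sqnorm /= => /eqP E; apply/eqP; nia.
apply/eqP; rewrite -leqn0 leqNgt -has_count; apply/hasPn=> -[x y] S; apply/negP=> Txy.
have [[a aE] [b bE]] := Td _ _ S Txy.
move: S; rewrite mem_rep /sqnorm /= => /eqP E; case/negP: (negbT pN).
apply/dvdnP; exists (Z.to_nat (a * a + b * b)); nia.
Qed.

(** With pi = u + v i, multiplication by pi reaches exactly the multiples of pi. Divisibility of z
    by pi means that p divides z times conj pi; testing the real part u x + v y is enough. *)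
Lemma size_rep_split p N (u v : Z) : prime p -> (u * u + v * v)%Z = Z.of_nat p ->
  size (rep N) =
  count (fun z => ((u * z.1 + v * z.2) mod Z.of_nat p =? 0)%Z) (rep (p * N)).
Proof.
move=> pP uvE; have p0 := prime_gt0 pP.
apply: (@size_count_image _ (fun z => (u * z.1 - v * z.2, u * z.2 + v * z.1)%Z)); rewrite ?rep_uniq //.
- move=> [a b] [c d] [] /= h1 h2.
  have pz : Z.of_nat p <> 0%Z by lia.
  congr (_, _); apply: (Z.mul_reg_l _ _ _ pz); rewrite -uvE.
    transitivity (u * (u * a - v * b) + v * (u * b + v * a))%Z; first by zring.
    by rewrite h1 h2; zring.
  transitivity (u * (u * b + v * a) - v * (u * a - v * b))%Z; first by zring.
  by rewrite h1 h2; zring.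
- move=> [a b]; rewrite !mem_rep /sqnorm /= => /eqP E; apply/andP; split.
    apply/Z.eqb_eq; have -> : (u * (u * a - v * b) + v * (u * b + v * a) = a * Z.of_nat p)%Z by rewrite -uvE; zring.
    by rewrite Z.mod_mul //; lia.
  apply/eqP; rewrite Nat2Z.inj_mul -E -uvE. zring.
move=> [x y]; rewrite mem_rep /sqnorm /= => /eqP E /Z.eqb_eq h.
have {h} [a aE] : (Z.of_nat p | u * x + v * y)%Z by apply/Z.mod_divide => //; lia.
(* The squares of the real and imaginary parts of z times conj pi add up to p * (p N), so p divides
   the square of the imaginary part too. *)
have [b bE] : (Z.of_nat p | u * y - v * x)%Z.
  apply: prime_Zdvd_sqr => //; exists (Z.of_nat p * Z.of_nat N - a * a * Z.of_nat p)%Z.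
  transitivity ((u * u + v * v) * (x * x + y * y) - (u * x + v * y) * (u * x + v * y))%Z; first by zring.
  by rewrite E aE uvE Nat2Z.inj_mul; zring.
have pz : Z.of_nat p <> 0%Z by lia.
have xE : x = (u * a - v * b)%Z.
  apply: (Z.mul_reg_l _ _ _ pz).
  transitivity (u * (a * Z.of_nat p) - v * (b * Z.of_nat p))%Z; last by zring.
  by rewrite -aE -bE -uvE; zring.
have yE : y = (u * b + v * a)%Z.
  apply: (Z.mul_reg_l _ _ _ pz).
  transitivity (u * (b * Z.of_nat p) + v * (a * Z.of_nat p))%Z; last by zring.
  by rewrite -aE -bE -uvE; zring.
exists (a, b); last by rewrite /= xE yE; congr (_, _); zring.
rewrite mem_rep /sqnorm /=; apply/eqP; apply: (Z.mul_reg_l _ _ _ pz).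
rewrite -Nat2Z.inj_mul -E -{1}uvE xE yE; zring.
Qed.

(* Inclusion-exclusion: with p = pi * conj pi, a Gaussian integer of norm p N is a multiple of pi or of conj pi,
   and it is a multiple of both exactly when p divides it. *)
Lemma size_rep_prime1 p N : prime p -> p %% 4 = 1 ->
  size (rep (p * N)) + (if p %| N then size (rep (N %/ p)) else 0) = 2 * size (rep N).
Proof.
move=> pP p4; have [u0 [v0 uvE0]] := prime_sum_two_squares pP p4.
pose u := Z.of_nat u0; pose v := Z.of_nat v0.
have uvE : (u * u + v * v = Z.of_nat p)%Z by rewrite /u /v; lia.
pose P z := ((u * z.1 + v * z.2) mod Z.of_nat p =? 0)%Z.
pose Q z := ((u * z.1 + (- v) * z.2) mod Z.of_nat p =? 0)%Z.
have p0 := prime_gt0 pP; have pz : Z.of_nat p <> 0%Z by lia.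
have dvdE c : (c mod Z.of_nat p =? 0)%Z -> (Z.of_nat p | c)%Z.
  by move=> /Z.eqb_eq h; apply/Z.mod_divide.
have edvd c : (Z.of_nat p | c)%Z -> (c mod Z.of_nat p =? 0)%Z.
  by move=> h; apply/Z.eqb_eq/Z.mod_divide.
(* If p divided [w], then w^2 <= p would force w = 0, and p would be the square of the other
   coordinate. *)
have npd w : (w = u \/ w = v) -> ~ (Z.of_nat p | 2 * w)%Z.
  move=> wE /(prime_Zdvd_mul pP)[/Z.divide_pos_le | [k kE]].
    by have := prime_gt1 pP; lia.
  have [n nE] : exists n : nat, (w * w + Z.of_nat n * Z.of_nat n = Z.of_nat p)%Z.
    by case: wE => ->; [exists v0|exists u0]; rewrite -uvE /u /v; zring.
  have p1 := prime_gt1 pP.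
  have kk : (k * k * (Z.of_nat p * Z.of_nat p) <= Z.of_nat p)%Z.
    transitivity (w * w)%Z; first by rewrite kE; apply/Z.eq_le_incl; zring.
    by rewrite -nE; have := Z.square_nonneg (Z.of_nat n); lia.
  have k0 : k = 0%Z.
    case: (Z.eq_dec k 0) => // kn0.
    have k1 : (1 <= k * k)%Z by clear -kn0; nia.
    have pp : (Z.of_nat p < Z.of_nat p * Z.of_nat p)%Z by clear -p1; nia.
    by clear -kk k1 pp; nia.
  case: (@prime_nsquare n); rewrite (_ : n * n = p) //.
  by move: nE; rewrite kE k0; clear; lia.
have E1 := size_rep_split N pP uvE.
have E2 : size (rep N) = count Q (rep (p * N)) by apply: size_rep_split => //; lia.
have E3 : count (predI P Q) (rep (p * N)) = if p %| N then size (rep (N %/ p)) else 0.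
  apply: count_rep_prime_mul => //.
    by move=> a b; apply/andP; split; apply: edvd => /=; [exists (u * a + v * b)%Z|exists (u * a - v * b)%Z]; zring.
  move=> x y _ /andP[/dvdE[/= k kE] /dvdE[/= l lE]]; split.
    have /(prime_Zdvd_mul pP)[/npd h|//] : (Z.of_nat p | (2 * u) * x)%Z by exists (k + l)%Z; lia.
    by case: h; left.
  have /(prime_Zdvd_mul pP)[/npd h|//] : (Z.of_nat p | (2 * v) * y)%Z by exists (k - l)%Z; lia.
  by case: h; right.
have E4 : count (predU P Q) (rep (p * N)) = size (rep (p * N)).
  apply/eqP; rewrite -all_count; apply/allP => -[x y]; rewrite mem_rep /sqnorm /= => /eqP E.
  (* The product equals u^2 (x^2 + y^2) - y^2 p, so one of the two tests always succeeds. *)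
  have : (Z.of_nat p | (u * x + v * y) * (u * x + (- v) * y))%Z.
    exists (u * u * Z.of_nat N - y * y)%Z.
    transitivity (u * u * (x * x + y * y) - y * y * (u * u + v * v))%Z; first by zring.
    by rewrite E uvE Nat2Z.inj_mul; zring.
  by move=> /(prime_Zdvd_mul pP)[] /edvd h; apply/orP; [left|right].
have := count_predUI P Q (rep (p * N)); rewrite E3 E4 => ->.
by rewrite -E1 -E2 mul2n addnn.
Qed.

(** The usual cofactor has alternating signs. Adding a multiple of a + b on the left keeps the
    induction inside the natural numbers. *)
Lemma dvdn_add_odd_exp a b j : a + b %| a ^ (2 * j + 1) + b ^ (2 * j + 1).
Proof.
elim: j => [|j IH]; first by rewrite muln0 add0n !expn1.
have -> : 2 * j.+1 + 1 = (2 * j + 1).+2 by lia.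
rewrite -(dvdn_addl _ (dvdn_mulr (a * b ^ (2 * j + 1)) (dvdnn (a + b)))).
have -> : a ^ (2 * j + 1).+2 + b ^ (2 * j + 1).+2 + (a + b) * (a * b ^ (2 * j + 1)) =
   a * a * (a ^ (2 * j + 1) + b ^ (2 * j + 1)) + (a + b) * b * b ^ (2 * j + 1) by rewrite !expnS; lia.
by apply: dvdn_add; [exact: dvdn_mull|rewrite -mulnA dvdn_mulr].
Qed.

(** Since (p - 1) / 2 is odd, x^2 + y^2 divides x^(p-1) + y^(p-1). If p divided neither x nor y,
    Fermat would make this 2 modulo p, and p would divide 2. *)
Lemma prime3_dvd_sum_squares p x y : prime p -> p %% 4 = 3 ->
  p %| x * x + y * y -> (p %| x) && (p %| y).
Proof.
move=> pP p4 h.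
have odd_p : ~~ (p %| 2) by apply/negP => /dvdn_leq; lia.
have sx : (p %| x) = (p %| y).
  apply/idP/idP => d.
    by move: h; rewrite (dvdn_addr _ (dvdn_mull x d)) Euclid_dvdM // orbb.
  by move: h; rewrite (dvdn_addl _ (dvdn_mull y d)) Euclid_dvdM // orbb.
rewrite -sx andbb; apply/negPn/negP => px.
have py : ~~ (p %| y) by rewrite -sx.
have F z : ~~ (p %| z) -> z ^ p.-1 = 1 %[mod p].
  move=> pz; rewrite -(totient_prime pP); apply: Euler_exp_totient.
  by rewrite coprime_sym prime_coprime.
case/negP: odd_p.
have := dvdn_trans h (dvdn_add_odd_exp (x * x) (y * y) (p %/ 4)).
have E z : (z * z) ^ (2 * (p %/ 4) + 1) = z ^ p.-1.
  by rewrite mulnn -expnM; congr expn; lia.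
by rewrite !E /dvdn -modnDm (F _ px) (F _ py) modnDm.
Qed.

Lemma size_rep_prime3 p N : prime p -> p %% 4 = 3 ->
  size (rep (p * N)) = if p %| N then size (rep (N %/ p)) else 0.
Proof.
move=> pP p4; rewrite -(count_predT (rep (p * N))).
apply: count_rep_prime_mul => // x y; rewrite mem_rep /sqnorm /= => /eqP E _.
have : p %| Z.abs_nat x * Z.abs_nat x + Z.abs_nat y * Z.abs_nat y.
  by apply/dvdnP; exists N; nia.
case/(prime3_dvd_sum_squares pP p4)/andP=> /dvdnP[a aE] /dvdnP[b bE]; split.
  by case: (Z.abs_eq_or_opp x) => xE; [exists (Z.of_nat a)|exists (- Z.of_nat a)%Z]; lia.
by case: (Z.abs_eq_or_opp y) => xE; [exists (Z.of_nat b)|exists (- Z.of_nat b)%Z]; lia.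
Qed.

(** * The divisor sum of chi_4 and its Hecke relation *)

Definition chi4 (n : nat) : R :=
  if n %% 4 == 1 then 1%R else if n %% 4 == 3 then (-1)%R else 0%R.

Lemma chi4M m n : chi4 (m * n) = (chi4 m * chi4 n)%R.
Proof.
rewrite /chi4 -modnMm.
have := ltn_pmod m (isT : 0 < 4); have := ltn_pmod n (isT : 0 < 4).
by case: (m %% 4) => [|[|[|[|?]]]] //; case: (n %% 4) => [|[|[|[|?]]]] //= *; lra.
Qed.

Definition chi4_sum (n : nat) : R := \big[Rplus/0%R]_(d <- divisors n) chi4 d.

Lemma sum_divisors_mul p n : 0 < p -> 0 < n ->
  \big[Rplus/0%R]_(d <- divisors (p * n) | p %| d) chi4 d = (chi4 p * chi4_sum n)%R.
Proof.
move=> p0 n0; have pn0 : 0 < p * n by rewrite muln_gt0 p0.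
have E : perm_eq [seq d <- divisors (p * n) | p %| d] [seq p * d | d <- divisors n].
  apply: uniq_perm; first by rewrite filter_uniq ?divisors_uniq.
    by rewrite map_inj_uniq ?divisors_uniq // => a b /eqP; rewrite eqn_pmul2l // => /eqP.
  move=> d; rewrite mem_filter -dvdn_divisors //; apply/andP/mapP.
    case=> /dvdnP[k ->]; rewrite mulnC dvdn_pmul2l // => kn.
    by exists k => //; rewrite -dvdn_divisors.
  by case=> k; rewrite -dvdn_divisors // => kn ->; rewrite dvdn_mulr // dvdn_pmul2l.
rewrite -big_filter (perm_big _ E) big_map /chi4_sum big_distrr.
by apply: eq_bigr => d _; rewrite chi4M.
Qed.

(** Divisors of p n prime to p are those of n, and the others are p times a divisor of n. The
    subtracted term removes from [chi4_sum n] the divisors of n that are multiples of p. *)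
Lemma chi4_sum_hecke p n : prime p -> 0 < n ->
  chi4_sum (p * n) = ((1 + chi4 p) * chi4_sum n -
    chi4 p * (if p %| n then chi4_sum (n %/ p) else 0))%R.
Proof.
move=> pP n0; have p0 := prime_gt0 pP.
rewrite {1}/chi4_sum (bigID (dvdn p)) sum_divisors_mul //.
have -> : \big[Rplus/0%R]_(d <- divisors (p * n) | ~~ (p %| d)) chi4 d =
          \big[Rplus/0%R]_(d <- divisors n | ~~ (p %| d)) chi4 d.
  rewrite -!(big_filter _ (fun d => ~~ (p %| d))); apply: perm_big.
  apply: uniq_perm; rewrite ?filter_uniq ?divisors_uniq // => d.
  rewrite !mem_filter -!dvdn_divisors ?muln_gt0 ?p0 //.
  by case: (boolP (p %| d)) => // pd; rewrite Gauss_dvdr // coprime_sym prime_coprime.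
have -> : chi4_sum n = (\big[Rplus/0%R]_(d <- divisors n | p %| d) chi4 d +
                        \big[Rplus/0%R]_(d <- divisors n | ~~ (p %| d)) chi4 d)%R.
  by rewrite {1}/chi4_sum (bigID (dvdn p)).
have -> : \big[Rplus/0%R]_(d <- divisors n | p %| d) chi4 d =
  (chi4 p * (if p %| n then chi4_sum (n %/ p) else 0))%R; last by simpl; lra.
case: ifP => [/dvdnP[m nE]|pn].
  rewrite nE mulnK // mulnC sum_divisors_mul //.
  by move: n0; rewrite nE muln_gt0 => /andP[].
rewrite Rmult_0_r big_seq_cond big1 // => d /andP[].
by rewrite -dvdn_divisors // => dn /dvdn_trans/(_ dn); rewrite pn.
Qed.

(** Strong induction removing the least prime factor: the three counting recurrences are the Hecke
    relation with chi_4(p) equal to 0, 1 and -1. *)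
Lemma size_rep_chi4_sum n : 0 < n -> INR (size (rep n)) = (4 * chi4_sum n)%R.
Proof.
have [m] := ubnP n; elim: m n => // m IH n nm n0.
case: (ltngtP n 1) => n1; [lia| |]; last first.
  rewrite n1 (_ : size (rep 1) = 4) //.
  by rewrite /chi4_sum (_ : divisors 1 = [:: 1]) // big_seq1 /chi4 /=; lra.
have pP := pdiv_prime n1; set p := pdiv n in pP.
have p1 := prime_gt1 pP; have p0 := prime_gt0 pP.
have [k nE] : exists k, n = p * k by have /dvdnP[k kE] := pdiv_dvd n; exists k; rewrite mulnC.
have k0 : 0 < k by case: k nE => //; rewrite muln0; lia.
have kn : k < n by rewrite nE; clear -k0 p1; nia.
have IHk : INR (size (rep k)) = (4 * chi4_sum k)%R by apply: IH => //; lia.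
have IHkp : p %| k -> INR (size (rep (k %/ p))) = (4 * chi4_sum (k %/ p))%R.
  move=> pk; apply: IH; last by rewrite divn_gt0 // dvdn_leq.
  by apply: leq_ltn_trans (leq_div k p) _; lia.
rewrite nE chi4_sum_hecke //.
have : p %% 4 < 4 by rewrite ltn_pmod.
case p4 : (p %% 4) => [|[|[|[|?]]]] //= _.
- case/primeP: pP => _ /(_ 2); rewrite {1}(divn_eq p 4) p4 addn0 -[4]/(2 * 2) mulnA dvdn_mull // => /(_ isT).
  by case/orP=> /eqP p2; rewrite -p2 in p4.
- have := size_rep_prime1 k pP p4 => /(congr1 INR); rewrite plus_INR mult_INR IHk.
  have -> : chi4 p = 1%R by rewrite /chi4 p4.
  by case: ifP IHkp => [pk /(_ isT) ->|pk _]; rewrite /=; lra.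
- have p2 : p = 2.
    case/primeP: pP => _ /(_ 2) H; have : 2 %| p by rewrite (divn_eq p 4) p4 dvdn_addr // dvdn_mull.
    by move=> /H /orP[] /eqP.
  by rewrite p2 size_rep_mul2 IHk (_ : chi4 2 = 0%R) //; lra.
rewrite size_rep_prime3 //; have -> : chi4 p = (-1)%R by rewrite /chi4 p4.
by case: ifP IHkp => [pk /(_ isT) ->|pk _]; rewrite /=; lra.
Qed.

Definition in_class (z : Z * Z) : bool := ((z.1 mod 5 =? 0) && (z.2 mod 5 =? 1))%Z.

(* For [n = 1] modulo 5, exactly one of the four rotations of a representation lies in the class [(0, 1)]. *)
Lemma count_in_class n : n %% 5 = 1 -> size (rep n) = 4 * count in_class (rep n).
Proof.
move=> n5.
pose rot (z : Z * Z) : Z * Z := (- z.2, z.1)%Z.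
have rotI : injective rot by move=> [a b] [c d] [] ? ?; congr (_, _); lia.
have cnt P : count (preim rot P) (rep n) = count P (rep n).
  rewrite -size_filter; apply: (@size_count_image _ rot); rewrite ?(filter_uniq _ (rep_uniq _)) ?rep_uniq //.
    move=> [a b]; rewrite mem_filter !mem_rep /sqnorm /= => /andP[-> /eqP E].
    by apply/eqP; rewrite -E; zring.
  move=> [a b] S Pab; exists (b, - a)%Z; last by rewrite /rot /= Z.opp_involutive.
  rewrite mem_filter /= /rot /= Z.opp_involutive Pab /=.
  by move: S; rewrite !mem_rep /sqnorm /= => /eqP <-; apply/eqP; zring.
pose P1 := preim rot in_class; pose P2 := preim rot P1; pose P3 := preim rot P2.
have E1 : count P1 (rep n) = count in_class (rep n) by rewrite cnt.
have E2 : count P2 (rep n) = count in_class (rep n) by rewrite cnt.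
have E3 : count P3 (rep n) = count in_class (rep n) by rewrite cnt.
have H s : {in s, forall z, in_class z + (P1 z + (P2 z + P3 z)) = 1} ->
    size s = count in_class s + (count P1 s + (count P2 s + count P3 s)).
  elim: s => //= z s IH h; rewrite {}IH; first by have := h z (mem_head _ _); lia.
  by move=> w ws; apply: h; rewrite inE ws orbT.
rewrite -[4 * _]/(_ + (_ + (_ + (_ + 0)))) addn0 -{2}E1 -{2}E2 -{2}E3; apply: H.
move=> [a b]; rewrite mem_rep /sqnorm => /eqP E.
have {}E : (a * a + b * b)%Z = Z.of_nat n by [].
rewrite /P3 /P2 /P1 /in_class /rot /=.
have aE := Z.div_mod a 5 ltac:(done); have bE := Z.div_mod b 5 ltac:(done).
have am := Z.mod_pos_bound a 5 ltac:(done); have bm := Z.mod_pos_bound b 5 ltac:(done).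
have {}E : (((a mod 5) * (a mod 5) + (b mod 5) * (b mod 5)) mod 5 = 1)%Z.
  move: E aE bE; move: (a mod 5)%Z (b mod 5)%Z (a / 5)%Z (b / 5)%Z => r s q t E aE bE.
  have : (r * r + s * s = Z.of_nat n - 5 * (q * (a + r) + t * (b + s)))%Z.
    by rewrite -E aE bE; zring.
  move: (r * r + s * s)%Z (q * _ + _)%Z => u v. move=> ->.
  by rewrite Zminus_mod Z.mul_comm Z_mod_mult (_ : Z.of_nat n mod 5 = 1)%Z //; zmlia.
have na : ((- a) mod 5 = (- (a mod 5)) mod 5)%Z by zmlia.
have nb : ((- b) mod 5 = (- (b mod 5)) mod 5)%Z by zmlia.
rewrite ?Z.opp_involutive na nb; move: E.
move: am bm; move: (a mod 5)%Z (b mod 5)%Z => r s am bm.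
(* Squares modulo 5 are 0, 1, 4, so r^2 + s^2 = 1 leaves (0, 1), (0, 4), (1, 0), (4, 0): a single
   orbit of the rotation. *)
have : (r = 0 \/ r = 1 \/ r = 2 \/ r = 3 \/ r = 4)%Z by lia.
have : (s = 0 \/ s = 1 \/ s = 2 \/ s = 3 \/ s = 4)%Z by lia.
by case=> [|[|[|[|]]]] ->; case=> [|[|[|[|]]]] ->.
Qed.

Open Scope R_scope.

(** * Disk sums and Dirichlet's hyperbola method *)

Lemma sum_const_cond (T : Type) (s : seq T) (P : pred T) (c : R) :
  \big[Rplus/R0]_(z <- s | P z) c = INR (count P s) * c.
Proof.
elim: s => [|z s IH]; first by rewrite big_nil /= Rmult_0_l.
rewrite big_cons IH /=; case: (P z); rewrite ?add1n ?add0n ?S_INR //; ring.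
Qed.

Lemma sum_abs_le (T : eqType) (s : seq T) (P : pred T) (F G : T -> R) :
  (forall i, i \in s -> P i -> Rabs (F i) <= G i) ->
  Rabs (\big[Rplus/R0]_(i <- s | P i) F i) <= \big[Rplus/R0]_(i <- s | P i) G i.
Proof.
move=> h; rewrite big_seq_cond [X in _ <= X]big_seq_cond.
apply: (big_ind2 (fun x y => Rabs x <= y)); first by rewrite Rabs_R0; apply: Rle_refl.
  by move=> x1 x2 y1 y2 h1 h2; apply: Rle_trans (Rabs_triang _ _) _; lra.
by move=> i /andP[]; apply: h.
Qed.

Lemma sum_pred1_uniq (T : eqType) (s : seq T) (j : T) (F : T -> R) :
  uniq s -> j \in s -> \big[Rplus/R0]_(i <- s | i == j) F i = F j.
Proof. by move=> Us js; rewrite -big_filter filter_pred1_uniq // big_seq1. Qed.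

Lemma sqnorm_ge0 z : (0 <= sqnorm z)%Z.
Proof. by rewrite /sqnorm; nia. Qed.

Lemma in_class_sqnorm z k : in_class z -> sqnorm z = Z.of_nat k -> (k %% 5 = 1)%N.
Proof.
case: z => a b; rewrite /in_class /sqnorm /= => /andP[/Z.eqb_eq a0 /Z.eqb_eq b1] E.
have [q qE] : exists q, a = (5 * q)%Z by exists (a / 5)%Z; zmlia.
have [t tE] : exists t, b = (5 * t + 1)%Z by exists (b / 5)%Z; zmlia.
have : (Z.of_nat k = 5 * (5 * q * q + 5 * t * t + 2 * t) + 1)%Z by rewrite -E qE tE; zring.
by move: (_ + _ + _)%Z => u; lia.
Qed.

(** The fibre over a norm k = 1 mod 5 has r_2(k) / 4 points, and other norms do not occur in the
    class. [L] is described by membership only, so any enumeration of the disk fits. *)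
Lemma sum_by_sqnorm (X : nat) (L : seq (Z * Z)) (h : nat -> R) : uniq L ->
  (forall z, (z \in L) = in_class z && (sqnorm z <=? Z.of_nat X)%Z) ->
  \big[Rplus/R0]_(z <- L) h (Z.to_nat (sqnorm z)) =
  \big[Rplus/R0]_(1 <= k < X.+1 | (k %% 5 == 1)%N) (h k * chi4_sum k).
Proof.
move=> UL memL.
(* Each term becomes a sum over k with one surviving index; exchanging the sums then groups the
   points by norm. *)
have E z : z \in L -> h (Z.to_nat (sqnorm z)) =
    \big[Rplus/R0]_(1 <= k < X.+1 | k == Z.to_nat (sqnorm z)) h k.
  rewrite memL => /andP[cz /Z.leb_le zX].
  have n0 := @sqnorm_ge0 z.
  have := in_class_sqnorm (k := Z.to_nat (sqnorm z)) cz (esym (Z2Nat.id _ n0)).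
  move: n0 zX; move: (sqnorm z) => n n0 zX n1.
  rewrite sum_pred1_uniq ?iota_uniq // mem_index_iota.
  by apply/andP; split; [case: (Z.to_nat n) n1|lia].
rewrite big_seq (eq_bigr _ E) -big_seq.
under eq_bigr do rewrite big_mkcond.
rewrite exchange_big [RHS]big_mkcond /=; apply: eq_big_nat => k /andP[k0 kX].
rewrite -big_mkcond sum_const_cond.
have -> : count (fun z => k == Z.to_nat (sqnorm z)) L =
          (if (k %% 5 == 1)%N then count in_class (rep k) else 0%N).
  rewrite -size_filter; case: eqP => k5; last first.
    apply/eqP; rewrite size_filter -leqn0 leqNgt -has_count; apply/hasPn => z.
    rewrite memL => /andP[cz _]; apply/negP => /eqP kE; apply: k5.
    by apply: (in_class_sqnorm cz); rewrite kE Z2Nat.id //; apply: sqnorm_ge0.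
  rewrite -size_filter; apply/perm_size/uniq_perm; rewrite ?(filter_uniq _ (rep_uniq _)) ?filter_uniq // => z.
  rewrite [LHS]mem_filter [RHS]mem_filter memL mem_rep; case: (in_class z); rewrite ?andbF //=.
  apply/andP/eqP => [[/eqP -> _]|zE]; first by rewrite Z2Nat.id //; apply: sqnorm_ge0.
  by rewrite zE; split; [apply/eqP|apply/Z.leb_le]; lia.
case: eqP => k5; last by rewrite Rmult_0_l.
have := size_rep_chi4_sum k0; rewrite (count_in_class k5) mult_INR.
by rewrite (_ : INR 4 = 4) /=; [|lra]; move=> ?; nra.
Qed.

Lemma sum_divisors_pairs (X : nat) (P : pred nat) (G : nat -> nat -> R) :
  \big[Rplus/R0]_(1 <= k < X.+1 | P k)
     (\big[Rplus/R0]_(d <- divisors k) G d (k %/ d)) =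
  \big[Rplus/R0]_(1 <= d < X.+1)
     \big[Rplus/R0]_(1 <= e < X.+1 | (d * e <= X)%N && P (d * e)%N) G d e.
Proof.
have memI n : (n \in index_iota 1 X.+1) = (0 < n <= X)%N by rewrite mem_index_iota.
have E k : (1 <= k < X.+1)%N ->
    (if P k then \big[Rplus/R0]_(d <- divisors k) G d (k %/ d) else R0) =
    \big[Rplus/R0]_(1 <= d < X.+1) \big[Rplus/R0]_(1 <= e < X.+1)
      (if (k == d * e)%N then if P (d * e)%N then G d e else R0 else R0).
  move=> /andP[k0 kX].
  have -> : (if P k then \big[Rplus/R0]_(d <- divisors k) G d (k %/ d) else R0) =
      \big[Rplus/R0]_(d <- divisors k) (if P k then G d (k %/ d) else R0).
    by case: (P k); last by rewrite big1.
  have -> : \big[Rplus/R0]_(d <- divisors k) (if P k then G d (k %/ d) else R0) =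
    \big[Rplus/R0]_(1 <= d < X.+1 | (d %| k)%N) (if P k then G d (k %/ d) else R0).
    rewrite -[RHS]big_filter; apply: perm_big; apply: uniq_perm.
    - exact: divisors_uniq.
    - by rewrite filter_uniq ?iota_uniq.
    move=> d; rewrite mem_filter memI -dvdn_divisors //.
    case: (boolP (d %| k)%N) => //= dk; symmetry; apply/andP; split.
      by apply: dvdn_gt0 dk.
    by apply: leq_trans (dvdn_leq k0 dk) _; lia.
  rewrite big_mkcond; apply: eq_big_nat => d /andP[d0 dX].
  case: ifP => [/dvdnP[e kE]|dk]; last first.
    by rewrite big1 // => e _; case: eqP => // kE; rewrite kE dvdn_mulr in dk.
  have e0 : (0 < e)%N by case: e kE => // kE; rewrite kE in k0.
  rewrite kE mulnK // mulnC -big_mkcond.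
  rewrite (eq_bigl (fun i => i == e)); last first.
    by move=> i; rewrite eqn_pmul2l // eq_sym.
  rewrite sum_pred1_uniq ?iota_uniq // memI e0 /=.
  by apply: leq_trans (leq_pmulr e d0) _; lia.
rewrite big_mkcond (eq_big_nat _ _ E) exchange_big; apply: eq_big_nat => d /andP[d0 dX].
rewrite exchange_big [RHS]big_mkcond; apply: eq_big_nat => e /andP[e0 eX].
rewrite -big_mkcond; case: leqP => deX /=.
  by rewrite sum_pred1_uniq ?iota_uniq // memI muln_gt0 d0 e0.
by rewrite big_nat_cond big_pred0 // => k; apply/negbTE/negP; lia.
Qed.

Definition psum (u : nat -> R) (N : nat) : R := \big[Rplus/R0]_(1 <= d < N.+1) u d.

Lemma psum_floor (u : nat -> R) (X e : nat) : (0 < e)%N ->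
  \big[Rplus/R0]_(1 <= d < X.+1 | (d * e <= X)%N) u d = psum u (X %/ e).
Proof.
move=> e0; rewrite /psum (@big_nat_widen _ _ _ 1 (X %/ e).+1 X.+1); last first.
  by rewrite ltnS leq_div.
by apply: eq_bigl => d; rewrite ltnS leq_divRL.
Qed.

(** If d > Y and d e <= Y^2 then e <= Y, so the pairs beyond d = Y are summed over d first, from Y +
    1 to Y^2 / e. *)
Lemma hyperbola_split (u v : nat -> R) (Y : nat) :
  \big[Rplus/R0]_(1 <= d < (Y * Y).+1)
    \big[Rplus/R0]_(1 <= e < (Y * Y).+1 | (d * e <= Y * Y)%N) (u d * v e) =
  \big[Rplus/R0]_(1 <= d < Y.+1) (u d * psum v (Y * Y %/ d)) +
  \big[Rplus/R0]_(1 <= e < Y.+1) (v e * (psum u (Y * Y %/ e) - psum u Y)).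
Proof.
have YX : (Y <= Y * Y)%N by case: Y => // n; rewrite leq_pmulr.
rewrite (@big_cat_nat _ _ _ Y.+1) //=; congr Rplus.
  apply: eq_big_nat => d /andP[d0 _]; rewrite -psum_floor // big_distrr.
  by apply: eq_bigl => e; rewrite mulnC.
have -> : \big[Rplus/R0]_(Y.+1 <= d < (Y * Y).+1)
     \big[Rplus/R0]_(1 <= e < (Y * Y).+1 | (d * e <= Y * Y)%N) (u d * v e) =
   \big[Rplus/R0]_(1 <= e < (Y * Y).+1)
     \big[Rplus/R0]_(Y.+1 <= d < (Y * Y).+1 | (d * e <= Y * Y)%N) (u d * v e).
  by under eq_bigr do rewrite big_mkcond; rewrite exchange_big;
    apply: eq_bigr => e _; rewrite -big_mkcond.
rewrite (@big_cat_nat _ _ _ Y.+1) //= [X in _ + X]big1_seq; last first.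
  move=> e /andP[_]; rewrite mem_index_iota => /andP[eY _].
  rewrite big_nat_cond big_pred0 // => d; apply/negbTE/negP => /andP[/andP[dY _] deX].
  have : (Y.+1 * Y.+1 <= d * e)%N by rewrite leq_mul.
  by lia.
rewrite Rplus_0_r; apply: eq_big_nat => e /andP[e0 eY].
rewrite -psum_floor //.
have -> : \big[Rplus/R0]_(1 <= d < (Y * Y).+1 | (d * e <= Y * Y)%N) u d =
  psum u Y + \big[Rplus/R0]_(Y.+1 <= d < (Y * Y).+1 | (d * e <= Y * Y)%N) u d.
  rewrite (@big_cat_nat _ _ _ Y.+1) //=; congr Rplus.
  rewrite big_nat_cond /psum [RHS]big_nat_cond; apply: eq_bigl => d; rewrite andbT.
  by case: (boolP (1 <= d < Y.+1)%N) => [/andP[d0 dY]|_ /=]; rewrite ?andFb // leq_mul.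
rewrite -big_distrl /=; lra.
Qed.

(** The denominator is N + 1 so that the bound also says something at N = 0, where division by zero
    would otherwise occur. *)
Definition conv_rate (u : nat -> R) (l : R) : Prop :=
  exists C, forall N, Rabs (psum u N - l) <= C / INR N.+1.

Lemma psumS u N : psum u N.+1 = psum u N + u N.+1.
Proof. by rewrite /psum big_nat_recr. Qed.

Lemma INRS_gt0 n : 0 < INR n.+1.
Proof. exact: lt_0_INR (Nat.lt_0_succ n). Qed.

Lemma psum_le_linear u c N : (forall d, (0 < d <= N)%N -> u d <= c) -> psum u N <= INR N * c.
Proof.
elim: N => [|N IH] h; first by rewrite /psum big_geq //= ; lra.
rewrite psumS S_INR Rmult_plus_distr_r Rmult_1_l.
apply: Rplus_le_compat; last by apply: h; rewrite leqnn.
by apply: IH => d /andP[d0 dN]; apply: h; rewrite d0 ltnW.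
Qed.

Lemma psum_abs_le u v N : (forall d, (0 < d <= N)%N -> Rabs (u d) <= v d) ->
  Rabs (psum u N) <= psum v N.
Proof. by move=> h; apply: sum_abs_le => d; rewrite mem_index_iota => dN _; apply: h. Qed.

Lemma conv_rate_ge0 u l : conv_rate u l ->
  exists2 C, 0 <= C & forall N, Rabs (psum u N - l) <= C / INR N.+1.
Proof.
case=> C h; exists C => //; have := h 0%N; have := Rabs_pos (psum u 0 - l).
by rewrite /= Rdiv_1_r; lra.
Qed.

Lemma conv_rate_term u l : conv_rate u l ->
  exists2 K, 0 <= K & forall d, (0 < d)%N -> Rabs (u d) <= K / INR d.
Proof.
move=> /conv_rate_ge0[C C0 h]; exists (2 * C); first by lra.
case=> // d _; have := h d; have := h d.+1; rewrite psumS.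
have d0 := INRS_gt0 d; have d1 := INRS_gt0 d.+1.
have : C / INR d.+2 <= C / INR d.+1.
  apply: Rmult_le_compat_l => //; apply: Rinv_le_contravar => //; rewrite [X in _ <= X]S_INR; lra.
rewrite (_ : 2 * C / INR d.+1 = C / INR d.+1 + C / INR d.+1); last by field; lra.
by split_Rabs; lra.
Qed.

(** Telescopes 1 / (N + 1) <= 2 (sqrt (N + 1) - sqrt N). This is weaker than a logarithmic bound,
    but it is only to be divided by Y + 1. *)
Lemma harmonic_le_sqrt N : psum (fun d => / INR d) N <= 2 * sqrt (INR N).
Proof.
elim: N => [|N IH]; first by rewrite /psum big_geq //= sqrt_0; lra.
rewrite psumS; have n0 := pos_INR N; have n1 := INRS_gt0 N.
have s0 := sqrt_pos (INR N); have s1 := sqrt_lt_R0 _ n1.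
have e0 := sqrt_sqrt _ n0; have e1 := sqrt_sqrt (INR N.+1) (Rlt_le _ _ n1).
suff : / INR N.+1 <= 2 * (sqrt (INR N.+1) - sqrt (INR N)) by lra.
have sq : sqrt (INR N.+1) * sqrt (INR N.+1) = sqrt (INR N) * sqrt (INR N) + 1.
  by rewrite e1 e0 S_INR.
rewrite -{1}e1; move: s0 s1 sq; clear; move: (sqrt (INR N)) (sqrt (INR N.+1)) => b a b0 a0 ab.
have a2 : 0 < a * a by nra.
have ba : b < a by nra.
have a1 : 1 <= a by nra.
apply: (Rmult_le_reg_r (a * a)) => //; rewrite Rinv_l; last by lra.
have : 0 <= (a - b) * (2 * (a * a) - (a + b)) by apply: Rmult_le_pos; nra.
nra.
Qed.

(* At the cutoff Y^2 / d the remainder of the second series is O(d / Y^2), so the factor 1/d in [u d] leaves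
   O(1 / Y) after summation. *)
Lemma hyperbola_sum_limit u v A B : conv_rate u A -> conv_rate v B ->
  is_lim_seq (fun Y => \big[Rplus/R0]_(1 <= d < (Y * Y).+1)
    \big[Rplus/R0]_(1 <= e < (Y * Y).+1 | (d * e <= Y * Y)%N) (u d * v e)) (A * B).
Proof.
move=> hu hv; have [Ku Ku0 uK] := conv_rate_term hu; have [Kv Kv0 vK] := conv_rate_term hv.
have {hu} [Cu Cu0 hu] := conv_rate_ge0 hu; have {hv} [Cv Cv0 hv] := conv_rate_ge0 hv.
pose w Y := / sqrt (INR Y.+1).
have w0 : is_lim_seq w 0.
  apply: (is_lim_seq_inv (fun Y => sqrt (INR Y.+1)) p_infty) => //.
  apply: (filterlim_comp _ _ _ (fun Y => INR Y.+1) sqrt _ (Rbar_locally p_infty)).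
    exact: (proj1 (is_lim_seq_incr_1 INR p_infty) is_lim_seq_INR).
  exact: filterlim_sqrt_p.
(* In this order: the cost of replacing the inner sums of [v] by [B], the cost of replacing
   [psum u Y] by [A], and the whole part e <= Y, d > Y. The slowest is the last, of size sqrt Y / (Y
   + 1), whence the common rate [w]. *)
pose K := 2 * (Ku * Cv) + Rabs B * Cu + 4 * (Kv * Cu).
have bound Y : Rabs (\big[Rplus/R0]_(1 <= d < (Y * Y).+1)
    \big[Rplus/R0]_(1 <= e < (Y * Y).+1 | (d * e <= Y * Y)%N) (u d * v e) - A * B) <= K * w Y.
  rewrite hyperbola_split.
  have y0 := pos_INR Y; have y1 := INRS_gt0 Y.
  have s1 := sqrt_lt_R0 _ y1; have ss := sqrt_sqrt _ (Rlt_le _ _ y1).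
  have w1 : / INR Y.+1 <= w Y.
    apply: Rinv_le_contravar => //; rewrite -[X in _ <= X]ss.
    have : 1 <= sqrt (INR Y.+1) by rewrite -sqrt_1; apply: sqrt_le_1_alt; rewrite S_INR; lra.
    nra.
  have E1 : Rabs (psum (fun d => u d * (psum v (Y * Y %/ d) - B)) Y) <= 2 * (Ku * Cv) * w Y.
    apply: Rle_trans (psum_abs_le (v := fun _ => Ku * Cv / (INR Y * INR Y)) _) _.
      move=> d /andP[d0 dY]; rewrite Rabs_mult.
      have dp : 0 < INR d by apply: lt_0_INR; apply/ltP.
      have yp : 0 < INR Y by apply: lt_0_INR; apply/ltP; apply: leq_trans dY.
      apply: Rle_trans (Rmult_le_compat _ _ _ _ (Rabs_pos _) (Rabs_pos _) (uK _ d0) (hv _)) _.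
      set q := INR (Y * Y %/ d).+1; have q0 : 0 < q := INRS_gt0 _.
      have qd : INR Y * INR Y <= INR d * q.
        rewrite -!mult_INR; apply: le_INR; apply/leP.
        by rewrite multE mulnC ltnW // -ltn_divLR.
      have -> : Ku / INR d * (Cv / q) = Ku * Cv * / (INR d * q) by field; lra.
      apply: Rmult_le_compat_l; first by apply: Rmult_le_pos.
      by apply: Rinv_le_contravar => //; nra.
    apply: Rle_trans (psum_le_linear (c := Ku * Cv / (INR Y * INR Y)) _) _.
      by move=> d _; apply: Rle_refl.
    have KC : 0 <= Ku * Cv by apply: Rmult_le_pos.
    case: (posnP Y) => [Y0|Yp].
      rewrite {1}Y0 /= Rmult_0_l; apply: Rmult_le_pos; first by lra.
      by left; apply: Rinv_0_lt_compat.
    have yp : 1 <= INR Y by have := le_INR 1 Y (elimT leP Yp).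
    rewrite (_ : INR Y * _ = Ku * Cv * / INR Y); last by field; lra.
    have -> : 2 * (Ku * Cv) * w Y = Ku * Cv * (2 * w Y) by ring.
    apply: Rmult_le_compat_l => //.
    apply: Rle_trans (Rmult_le_compat_l 2 _ _ _ w1); last by lra.
    rewrite S_INR; apply: (Rmult_le_reg_r (INR Y * (INR Y + 1))); first by nra.
    have -> : / INR Y * (INR Y * (INR Y + 1)) = INR Y + 1 by field; lra.
    have -> : 2 * / (INR Y + 1) * (INR Y * (INR Y + 1)) = 2 * INR Y by field; lra.
    lra.
  have c1 : Cu / INR Y.+1 <= Cu * w Y := Rmult_le_compat_l _ _ _ Cu0 w1.
  have E2 : Rabs (B * (psum u Y - A)) <= Rabs B * Cu * w Y.
    rewrite Rabs_mult Rmult_assoc; apply: Rmult_le_compat_l; first exact: Rabs_pos.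
    exact: Rle_trans (hu Y) c1.
  have E3 : Rabs (psum (fun e => v e * (psum u (Y * Y %/ e) - psum u Y)) Y) <= 4 * (Kv * Cu) * w Y.
    have KC : 0 <= Kv * Cu by apply: Rmult_le_pos.
    apply: Rle_trans (psum_abs_le (v := fun e => 2 * (Kv * Cu) / INR Y.+1 * / INR e) _) _.
      move=> e /andP[e0 eY]; rewrite Rabs_mult.
      have ep : 0 < INR e by apply: lt_0_INR; apply/ltP.
      have H : Rabs (psum u (Y * Y %/ e) - psum u Y) <= 2 * Cu / INR Y.+1.
        have : Cu / INR (Y * Y %/ e).+1 <= Cu / INR Y.+1.
          apply: Rmult_le_compat_l => //; apply: Rinv_le_contravar => //.
          by apply: le_INR; apply/leP; rewrite ltnS leq_divRL // leq_mul.
        have := hu (Y * Y %/ e)%N; have := hu Y.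
        rewrite (_ : 2 * Cu / INR Y.+1 = Cu / INR Y.+1 + Cu / INR Y.+1); last by field; lra.
        by split_Rabs; lra.
      apply: Rle_trans (Rmult_le_compat _ _ _ _ (Rabs_pos _) (Rabs_pos _) (vK _ e0) H) _.
      by apply: Req_le; field; lra.
    rewrite /psum -big_distrr -/(psum _ _).
    apply: Rle_trans (Rmult_le_compat_l _ _ _ _ (harmonic_le_sqrt Y)) _.
      by apply: Rmult_le_pos; [lra|left; apply: Rinv_0_lt_compat].
    have sle : sqrt (INR Y) <= sqrt (INR Y.+1) by apply: sqrt_le_1_alt; rewrite S_INR; lra.
    rewrite /w -{1}ss; move: s1 sle; clear -KC; move: (sqrt (INR Y)) (sqrt (INR Y.+1)) => a b b0 ab.
    have -> : 4 * (Kv * Cu) * / b = 2 * (Kv * Cu) / (b * b) * (2 * b) by field; lra.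
    apply: Rmult_le_compat_l; last by lra.
    by apply: Rmult_le_pos; [lra|left; apply: Rinv_0_lt_compat; nra].
  move: E2 E3; set p3 := psum (fun e => v e * _) Y => E2 E3.
  have E4 : \big[Rplus/R0]_(1 <= d < Y.+1) (u d * psum v (Y * Y %/ d)) =
     psum (fun d => u d * (psum v (Y * Y %/ d) - B)) Y + B * psum u Y.
    rewrite /psum big_distrr -big_split; apply: eq_bigr => d _ /=; ring.
  rewrite E4 -[X in _ + X - _]/p3; move: E1 E2 E3; rewrite /K.
  move: (psum (fun d => _) _) p3 (psum u Y) => p1 p3 p2 E1 E2 E3.
  rewrite (_ : _ - A * B = p1 + (B * (p2 - A)) + p3); last by ring.
  rewrite !Rmult_plus_distr_r.
  have := Rabs_triang (p1 + B * (p2 - A)) p3; have := Rabs_triang p1 (B * (p2 - A)); lra.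
apply: (is_lim_seq_le_le (fun Y => A * B - K * w Y) _ (fun Y => A * B + K * w Y)).
- by move=> Y; have := bound Y; split_Rabs; lra.
- rewrite -[X in is_lim_seq _ (Finite X)]Rminus_0_r -(Rmult_0_r K).
  by apply: is_lim_seq_minus'; [exact: is_lim_seq_const|apply: is_lim_seq_scal_l w0].
rewrite -[X in is_lim_seq _ (Finite X)]Rplus_0_r -(Rmult_0_r K).
by apply: is_lim_seq_plus'; [exact: is_lim_seq_const|apply: is_lim_seq_scal_l w0].
Qed.

(** * The Fourier series of log sin and of the sawtooth *)

Lemma is_derive_psum (f : nat -> R -> R) (df : nat -> R) (t : R) N :
  (forall d, (0 < d)%N -> is_derive (f d) t (df d)) ->
  is_derive (fun t => psum (fun d => f d t) N) t (psum df N).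
Proof.
move=> h; elim: N => [|N IH].
  rewrite /psum big_geq //; apply: (is_derive_ext (fun _ => 0)) => [s|].
    by rewrite big_geq.
  exact: is_derive_const.
rewrite psumS; apply: (is_derive_ext (fun t => psum (fun d => f d t) N + f N.+1 t)).
  by move=> s; rewrite psumS.
by apply: is_derive_plus => //; apply: h.
Qed.

Lemma abs_diff_le_deriv (f df : R -> R) (a b C : R) : a <= b ->
  (forall t, a <= t <= b -> is_derive f t (df t)) ->
  (forall t, a <= t <= b -> Rabs (df t) <= C) ->
  Rabs (f b - f a) <= C * (b - a).
Proof.
move=> ab hd hC; have [c [cab ->]] : exists c, a <= c <= b /\ f b - f a = df c * (b - a).
  have [|t tab|c [cab E]] := @MVT_gen f a b df.
  - by move=> t; rewrite Rmin_left // Rmax_right // => tab; apply: hd; lra.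
  - move: tab; rewrite Rmin_left // Rmax_right // => tab.
    by apply/continuity_pt_filterlim/ex_derive_continuous; exists (df t); apply: hd.
  by exists c; move: cab; rewrite Rmin_left // Rmax_right.
rewrite Rabs_mult (Rabs_pos_eq (b - a)); last by lra.
by apply: Rmult_le_compat_r; [lra|apply: hC].
Qed.

Lemma sin_half_ge (a t : R) : 0 < a -> a <= t <= PI -> 0 < sin (a / 2) <= sin (t / 2).
Proof.
move=> a0 [at_ tp]; have pi := PI_RGT_0; split; first by apply: sin_gt_0; lra.
by apply: sin_incr_1; lra.
Qed.

(* Integration by parts: the correction term absorbs the oscillation and leaves a derivative of size 1/M. *)
Lemma oscillation_bound (f : R -> R) (M phi a : R) : 0 < a <= PI -> 0 < M ->
  (forall t, a <= t <= PI -> is_derive f t (sin (M * t + phi) / (2 * sin (t / 2)))) ->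
  Rabs (f PI - f a) <= (PI / (4 * sin (a / 2) ^ 2) + / sin (a / 2)) / M.
Proof.
move=> [a0 ap] M0 hf; have pi := PI_RGT_0.
have sh t : a <= t <= PI -> 0 < sin (a / 2) <= sin (t / 2) by apply: sin_half_ge.
pose k t := cos (M * t + phi) / (2 * M * sin (t / 2)).
pose dg t := - (cos (M * t + phi) * cos (t / 2)) / (4 * M * sin (t / 2) ^ 2).
have := sh a (conj (Rle_refl a) ap) => -[s0 _].
move: sh s0; set s := sin (a / 2) => sh s0.
have Hg : Rabs ((f PI + k PI) - (f a + k a)) <= / (4 * M * s ^ 2) * (PI - a).
  apply: (@abs_diff_le_deriv (fun t => f t + k t) dg) => // t ta; have [_ st] := sh t ta.
    have -> : dg t = sin (M * t + phi) / (2 * sin (t / 2)) +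
      (- M * sin (M * t + phi) * sin (t / 2) - cos (M * t + phi) * (/ 2 * cos (t / 2))) / (2 * M * sin (t / 2) ^ 2).
      by rewrite /dg; field; lra.
    apply: is_derive_plus; first exact: hf.
    have tp : 0 < 2 * M * sin (t / 2) by apply: Rmult_lt_0_compat; lra.
    rewrite /k; auto_derive; rewrite -/(t / 2); first by apply: Rgt_not_eq.
    by field; lra.
  have dp : 0 < 4 * M * s ^ 2 by apply: Rmult_lt_0_compat; [lra|apply: pow_lt].
  have dst : 4 * M * s ^ 2 <= 4 * M * sin (t / 2) ^ 2.
    by apply: Rmult_le_compat_l; [lra|apply: pow_incr; lra].
  rewrite /dg Rabs_div; last by lra.
  rewrite (Rabs_pos_eq (4 * _ * _)); last by lra.
  have c1 : Rabs (- (cos (M * t + phi) * cos (t / 2))) <= 1.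
    rewrite Rabs_Ropp Rabs_mult -[X in _ <= X]Rmult_1_l.
    by apply: Rmult_le_compat; try apply: Rabs_pos; apply: Rabs_le; apply: COS_bound.
  rewrite -[X in _ <= X]Rmult_1_l.
  apply: Rmult_le_compat => //; first exact: Rabs_pos.
    by left; apply: Rinv_0_lt_compat; lra.
  exact: Rinv_le_contravar.
have kb t : a <= t <= PI -> Rabs (k t) <= / (2 * M * s).
  move=> ta; have [_ st] := sh t ta; have dp : 0 < 2 * M * s by apply: Rmult_lt_0_compat; lra.
  have dst : 2 * M * s <= 2 * M * sin (t / 2) by apply: Rmult_le_compat_l; lra.
  rewrite /k Rabs_div; last by lra.
  rewrite (Rabs_pos_eq (2 * _ * _)); last by lra.
  rewrite -[X in _ <= X]Rmult_1_l; apply: Rmult_le_compat; first exact: Rabs_pos.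
  - by left; apply: Rinv_0_lt_compat; lra.
  - by apply: Rabs_le; apply: COS_bound.
  exact: Rinv_le_contravar.
have k1 := kb PI (conj ap (Rle_refl PI)); have k2 := kb a (conj (Rle_refl a) ap).
have E : (PI / (4 * s ^ 2) + / s) / M = / (4 * M * s ^ 2) * PI + / (2 * M * s) + / (2 * M * s).
  by field; lra.
have : / (4 * M * s ^ 2) * (PI - a) <= / (4 * M * s ^ 2) * PI.
  by apply: Rmult_le_compat_l; [left; apply/Rinv_0_lt_compat/Rmult_lt_0_compat; [lra|apply: pow_lt]|lra].
by rewrite E; move: Hg k1 k2; set p := _ * (PI - a); set q := _ * PI; set r := / (2 * M * s); split_Rabs; lra.
Qed.

Lemma dirichlet_kernel_sin t N :
  2 * sin (t / 2) * psum (fun d => sin (INR d * t)) N = cos (t / 2) - cos ((INR N + / 2) * t).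
Proof.
elim: N => [|N IH]; first by rewrite /psum big_geq //= (_ : (0 + / 2) * t = t / 2); [ring|field].
rewrite psumS Rmult_plus_distr_l IH S_INR.
have -> : (INR N + / 2) * t = (INR N + 1) * t - t / 2 by field.
have -> : (INR N + 1 + / 2) * t = (INR N + 1) * t + t / 2 by field.
rewrite cos_minus cos_plus; ring.
Qed.

Lemma dirichlet_kernel_cos t N :
  2 * sin (t / 2) * psum (fun d => cos (INR d * t)) N = sin ((INR N + / 2) * t) - sin (t / 2).
Proof.
elim: N => [|N IH]; first by rewrite /psum big_geq //= (_ : (0 + / 2) * t = t / 2); [ring|field].
rewrite psumS Rmult_plus_distr_l IH S_INR.
have -> : (INR N + / 2) * t = (INR N + 1) * t - t / 2 by field.
have -> : (INR N + 1 + / 2) * t = (INR N + 1) * t + t / 2 by field.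
rewrite sin_minus sin_plus; ring.
Qed.

(** N + 1/2 is the frequency left by the Dirichlet kernels, hence the [M] of [oscillation_bound]. *)
Lemma conv_rate_of_half u l C : (forall N, Rabs (psum u N - l) <= C / (INR N + / 2)) ->
  conv_rate u l.
Proof.
move=> h; exists (2 * C) => N; apply: Rle_trans (h N) _.
have n0 := pos_INR N; rewrite S_INR.
have C0 : 0 <= C.
  have := h 0%N; rewrite /= => h0; have := Rabs_pos (psum u 0 - l) => h1.
  by move: h0; rewrite (_ : C / (0 + / 2) = 2 * C); [lra|field].
have -> : 2 * C / (INR N + 1) = C / ((INR N + 1) / 2) by field; lra.
by apply: Rmult_le_compat_l => //; apply: Rinv_le_contravar; lra.
Qed.

Lemma sin_INR_PI d : sin (INR d * PI) = 0.
Proof. by apply: sin_eq_0_1; exists (Z.of_nat d); rewrite -INR_IZR_INZ. Qed.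

Lemma cos_INR_PI d : cos (INR d * PI) = (-1) ^ d.
Proof.
elim: d => [|d IH]; first by rewrite Rmult_0_l cos_0.
by rewrite S_INR Rmult_plus_distr_r Rmult_1_l neg_cos IH /=; ring.
Qed.

(** The error, as a function of the angle, has the Dirichlet kernel as derivative, and it vanishes
    at [PI], where every sine is zero. *)
Lemma sin_series_rate a : 0 < a <= PI ->
  conv_rate (fun d => sin (INR d * a) / INR d) ((PI - a) / 2).
Proof.
move=> ha; pose C := PI / (4 * sin (a / 2) ^ 2) + / sin (a / 2).
apply: (@conv_rate_of_half _ _ C) => N; have n0 := pos_INR N; have [a0 ap] := ha.
pose f t := psum (fun d => sin (INR d * t) / INR d) N - (PI - t) / 2.
have f0 : f PI = 0.
  rewrite /f /psum big_nat_cond big1; first by field.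
  by move=> d _; rewrite sin_INR_PI /Rdiv Rmult_0_l.
have := @oscillation_bound f (INR N + / 2) 0 a ha ltac:(lra).
rewrite f0 Rminus_0_l Rabs_Ropp; apply=> t ta.
have [s0 st] := sin_half_ge a0 ta.
have -> : sin ((INR N + / 2) * t + 0) / (2 * sin (t / 2)) =
    psum (fun d => cos (INR d * t)) N + / 2.
  have := dirichlet_kernel_cos t N; rewrite Rplus_0_r => E.
  apply: (Rmult_eq_reg_l (2 * sin (t / 2))); last by lra.
  by rewrite Rmult_plus_distr_l E; field; lra.
rewrite /f; apply: is_derive_plus; last by auto_derive => //; field.
apply: is_derive_psum => d d0; auto_derive => //; field.
by apply: not_0_INR => dz; rewrite dz in d0.
Qed.

(** The derivative of the partial sum plus ln (1 + t) is (-t)^N / (1 + t), bounded by t^N on [0, 1].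
    Adding -c t^(N+1) / (N + 1) makes the derivative of constant sign for c = 1 and c = -1, so the
    mean value theorem gives both bounds without integration. *)
Lemma alternating_harmonic_rate : conv_rate (fun d => (-1) ^ d / INR d) (- ln 2).
Proof.
exists 1 => N; have n0 := pos_INR N; have n1 := INRS_gt0 N.
pose f c t := psum (fun d => (-1) ^ d * t ^ d / INR d) N + ln (1 + t) - c * t ^ N.+1 / INR N.+1.
have geo t : (1 + t) * psum (fun d => (-1) ^ d * t ^ d.-1) N = (- t) ^ N - 1.
  elim: N {n0 n1 f} => [|N IH]; first by rewrite /psum big_geq //=; ring.
  rewrite psumS Rmult_plus_distr_l IH (_ : - t = -1 * t) ?Rpow_mult_distr /=; ring.
have df c t : 0 <= t -> is_derive (f c) t ((- t) ^ N / (1 + t) - c * t ^ N).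
  move=> t0; have -> : (- t) ^ N / (1 + t) - c * t ^ N =
      psum (fun d => (-1) ^ d * t ^ d.-1) N + / (1 + t) - c * t ^ N.
    have -> : (- t) ^ N = (1 + t) * psum (fun d => (-1) ^ d * t ^ d.-1) N + 1 by rewrite geo; ring.
    by field; lra.
  apply: is_derive_minus; last by auto_derive => //; rewrite -/(INR N.+1); field; lra.
  apply: is_derive_plus; last by auto_derive; [lra|field; lra].
  apply: is_derive_psum => -[//|d] _; auto_derive => //.
  by rewrite -/(INR d.+1); move: (INR d.+1) (INRS_gt0 d) => q q0 /=; field; lra.
have f0 c : f c 0 = 0.
  rewrite /f Rplus_0_r ln_1 pow_ne_zero // /psum big_nat_cond big1; first by field; lra.
  by case=> [//|d] _; rewrite pow_ne_zero // Rmult_0_r /Rdiv Rmult_0_l.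
have f1 c : f c 1 = psum (fun d => (-1) ^ d / INR d) N + ln 2 - c / INR N.+1.
  rewrite /f pow1 Rmult_1_r (_ : 1 + 1 = 2); last by ring.
  by congr (_ + _ - _); apply: eq_bigr => d _; rewrite pow1 Rmult_1_r.
have mono c : exists2 t, 0 <= t <= 1 & f c 1 = (- t) ^ N / (1 + t) - c * t ^ N.
  have m0 : Rmin 0 1 = 0 by apply: Rmin_left; lra.
  have m1 : Rmax 0 1 = 1 by apply: Rmax_right; lra.
  have [|t tt|t [tt E]] := @MVT_gen (f c) 0 1 (fun t => (- t) ^ N / (1 + t) - c * t ^ N).
  - by move=> t; rewrite m0 m1 => tt; apply: df; lra.
  - rewrite m0 m1 in tt.
    by apply/continuity_pt_filterlim/ex_derive_continuous; eexists; apply: df; lra.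
  exists t; first by rewrite m0 m1 in tt.
  by move: E; rewrite f0; lra.
have bd t : 0 <= t <= 1 -> Rabs ((- t) ^ N / (1 + t)) <= t ^ N.
  move=> tt; rewrite Rabs_div; last by lra.
  rewrite -RPow_abs Rabs_Ropp (Rabs_pos_eq t) ?(Rabs_pos_eq (1 + t)); try lra.
  rewrite -[X in _ <= X]Rmult_1_r; apply: Rmult_le_compat_l; first by apply: pow_le; lra.
  by rewrite -[X in _ <= X]Rinv_1; apply: Rinv_le_contravar; lra.
have [t tt] := mono 1; have [r rr] := mono (- 1); rewrite !f1.
have := bd t tt; have := bd r rr; rewrite (_ : -1 / INR N.+1 = - (1 / INR N.+1)); last by field; lra.
by split_Rabs; lra.
Qed.

(** As for the sine series, with phase [PI / 2] in the kernel. The error at [PI] is now that of the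
    alternating harmonic series, which adds [Rabs K] to the constant. *)
Lemma cos_series_rate a : 0 < a <= PI ->
  conv_rate (fun d => cos (INR d * a) / INR d) (- ln (2 * sin (a / 2))).
Proof.
move=> ha; have [K hK] := alternating_harmonic_rate.
pose C := PI / (4 * sin (a / 2) ^ 2) + / sin (a / 2).
apply: (@conv_rate_of_half _ _ (C + Rabs K)) => N; have n0 := pos_INR N; have [a0 ap] := ha.
pose f t := psum (fun d => cos (INR d * t) / INR d) N + ln (2 * sin (t / 2)).
have fpi : Rabs (f PI) <= Rabs K / (INR N + / 2).
  rewrite /f sin_PI2 Rmult_1_r.
  have -> : psum (fun d => cos (INR d * PI) / INR d) N = psum (fun d => (-1) ^ d / INR d) N.
    by apply: eq_bigr => d _; rewrite cos_INR_PI.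
  have := hK N; rewrite /Rminus Ropp_involutive => h; apply: Rle_trans h _.
  apply: Rle_trans (Rmult_le_compat_r _ _ _ _ (Rle_abs K)) _.
    by left; apply: Rinv_0_lt_compat; apply: INRS_gt0.
  apply: Rmult_le_compat_l; first exact: Rabs_pos.
  by apply: Rinv_le_contravar; rewrite ?S_INR; lra.
have H : Rabs (f PI - f a) <= C / (INR N + / 2).
  apply: (@oscillation_bound f (INR N + / 2) (PI / 2) a ha); first by lra.
  move=> t ta; have [s0 st] := sin_half_ge a0 ta.
  have -> : sin ((INR N + / 2) * t + PI / 2) / (2 * sin (t / 2)) =
      psum (fun d => - sin (INR d * t)) N + cos (t / 2) / (2 * sin (t / 2)).
    have -> : psum (fun d => - sin (INR d * t)) N = - psum (fun d => sin (INR d * t)) N.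
      elim: N {n0 f fpi} => [|N IH]; first by rewrite /psum !big_geq // Ropp_0.
      by rewrite !psumS IH; ring.
    rewrite Rplus_comm -cos_sin; have E := dirichlet_kernel_sin t N.
    apply: (Rmult_eq_reg_l (2 * sin (t / 2))); last by lra.
    rewrite Rmult_plus_distr_l Ropp_mult_distr_r_reverse E; field; lra.
  rewrite /f; apply: is_derive_plus; last first.
    by auto_derive; rewrite -/(t / 2); [lra|field; lra].
  apply: is_derive_psum => d d0; auto_derive => //; field.
  by apply: not_0_INR => dz; rewrite dz in d0.
have -> : psum (fun d => cos (INR d * a) / INR d) N - - ln (2 * sin (a / 2)) = f a.
  by rewrite /f; ring.
rewrite /Rdiv Rmult_plus_distr_r; move: H fpi; rewrite /Rdiv; split_Rabs; lra.
Qed.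

(** * Characters modulo 5 and 20 *)

Definition lseries (F : nat -> R) (l : R) : Prop := conv_rate (fun d => F d / INR d) l.

Lemma lseries_ext F G l m : (forall d, F d = G d) -> l = m -> lseries F l -> lseries G m.
Proof.
move=> FG <- [C h]; exists C => N; rewrite (_ : psum _ N = psum (fun d => F d / INR d) N) //.
by apply: eq_bigr => d _; rewrite FG.
Qed.

Lemma lseriesD F G l m : lseries F l -> lseries G m -> lseries (fun d => F d + G d) (l + m).
Proof.
move=> [C h] [D k]; exists (C + D) => N; have n1 := INRS_gt0 N.
have -> : psum (fun d => (F d + G d) / INR d) N =
    psum (fun d => F d / INR d) N + psum (fun d => G d / INR d) N.
  by rewrite /psum -big_split; apply: eq_bigr => d _; rewrite /Rdiv Rmult_plus_distr_r.
rewrite /Rdiv Rmult_plus_distr_r; have := h N; have := k N; rewrite /Rdiv.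
by split_Rabs; lra.
Qed.

Lemma lseriesZ c F l : lseries F l -> lseries (fun d => c * F d) (c * l).
Proof.
move=> [C h]; exists (Rabs c * C) => N.
have -> : psum (fun d => c * F d / INR d) N = c * psum (fun d => F d / INR d) N.
  by rewrite /psum big_distrr; apply: eq_bigr => d _; rewrite /Rdiv /=; ring.
rewrite -Rmult_minus_distr_l Rabs_mult /Rdiv Rmult_assoc.
by apply: Rmult_le_compat_l; [exact: Rabs_pos|exact: h].
Qed.

Definition lseries_sin a (ha : 0 < a <= PI) :
  lseries (fun d => sin (INR d * a)) ((PI - a) / 2) := sin_series_rate ha.

Definition lseries_cos a (ha : 0 < a <= PI) :
  lseries (fun d => cos (INR d * a)) (- ln (2 * sin (a / 2))) := cos_series_rate ha.

Definition ev (j d : nat) : R := if (d %% 5 == j)%N || (d %% 5 == 5 - j)%N then 1 else 0.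
Definition od (j d : nat) : R :=
  if (d %% 5 == j)%N then 1 else if (d %% 5 == 5 - j)%N then -1 else 0.

(** The solutions are (1, 1), (4, 4), (2, 3), (3, 2). The index 1 products detect equal residues;
    the minus sign before the last product selects opposite residues among 2 and 3. *)
Lemma mul_eq1_mod5 d e : (if (d * e %% 5 == 1)%N then 1 else 0) =
  / 2 * (ev 1 d * ev 1 e + ev 2 d * ev 2 e + od 1 d * od 1 e - od 2 d * od 2 e).
Proof.
rewrite /ev /od -modnMm; have := ltn_pmod d (isT : (0 < 5)%N); have := ltn_pmod e (isT : (0 < 5)%N).
by case: (d %% 5)%N => [|[|[|[|[|?]]]]] //; case: (e %% 5)%N => [|[|[|[|[|?]]]]] //= *; lra.
Qed.

(* The names below carry angles in degrees: [angle18 k] is [k] times 18 degrees. *)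
Definition angle72 := 2 * PI / 5.
Definition cos72 := cos angle72.
Definition cos144 := cos (2 * angle72).
Definition sin72 := sin angle72.
Definition sin144 := sin (2 * angle72).

Lemma cos72_gt0 : 0 < cos72.
Proof. by have := PI_RGT_0; rewrite /cos72 /angle72 => pi; apply: cos_gt_0; lra. Qed.

Lemma sin72_gt0 : 0 < sin72.
Proof. by have := PI_RGT_0; rewrite /sin72 /angle72 => pi; apply: sin_gt_0; lra. Qed.

Lemma sqrt5_sqr : sqrt 5 * sqrt 5 = 5.
Proof. by apply: sqrt_sqrt; lra. Qed.

Lemma cos_2PI_minus x : cos (2 * PI - x) = cos x.
Proof. by rewrite -[RHS]cos_neg -(cos_period (- x) 1); congr cos; rewrite /=; ring. Qed.

Lemma sin_2PI_minus x : sin (2 * PI - x) = - sin x.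
Proof. by rewrite -sin_neg -(sin_period (- x) 1); congr sin; rewrite /=; ring. Qed.

(** Five times the angle is a full turn, so its triple and its double have the same cosine. This
    gives a cubic in [cos72] with the root 1; positivity selects the root of the quadratic
    factor. *)
Lemma cos72E : cos72 = (sqrt 5 - 1) / 4.
Proof.
have E2 : cos144 = 2 * cos72 * cos72 - 1 by rewrite /cos144 cos_2a_cos.
have E : cos72 * cos144 - sin72 * sin144 = cos144.
  rewrite /cos72 /sin72 /cos144 /sin144 -cos_plus (_ : angle72 + 2 * angle72 = 2 * PI - 2 * angle72).
    exact: cos_2PI_minus.
  by rewrite /angle72; field.
have Es2 : sin144 = 2 * sin72 * cos72 by rewrite /sin144 sin_2a.
have Es : sin72 * sin72 = 1 - cos72 * cos72 by have := sin2_cos2 angle72; rewrite /Rsqr -/sin72 -/cos72; lra.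
have c0 := cos72_gt0; have s0 := sin72_gt0.
have c1n : cos72 < 1 by nra.
have H : (cos72 - 1) * (4 * cos72 * cos72 + 2 * cos72 - 1) = 0.
  have : cos72 * cos144 - 2 * cos72 * (sin72 * sin72) - cos144 = 0 by rewrite Es2 in E; lra.
  by rewrite Es E2 => <-; ring.
have {}H : 4 * cos72 * cos72 + 2 * cos72 - 1 = 0 by case: (Rmult_integral _ _ H) => //; lra.
have r0 := sqrt_lt_R0 5 ltac:(lra); have r5 := sqrt5_sqr; nra.
Qed.

Lemma cos144E : cos144 = - (sqrt 5 + 1) / 4.
Proof. by rewrite /cos144 cos_2a_cos -/cos72 cos72E; have := sqrt5_sqr; lra. Qed.

Lemma sin72_sqr : sin72 * sin72 = (5 + sqrt 5) / 8.
Proof.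
have := sin2_cos2 angle72; rewrite /Rsqr -/sin72 -/cos72 cos72E; have := sqrt5_sqr; lra.
Qed.

Lemma sin144_sqr : sin144 * sin144 = (5 - sqrt 5) / 8.
Proof.
have := sin2_cos2 (2 * angle72); rewrite /Rsqr -/sin144 -/cos144 cos144E; have := sqrt5_sqr; lra.
Qed.

Lemma sin72_mul_sin144 : sin72 * sin144 = sqrt 5 / 4.
Proof.
rewrite /sin144 sin_2a -/sin72 -/cos72 (_ : sin72 * _ = 2 * cos72 * (sin72 * sin72)); last by ring.
rewrite sin72_sqr cos72E; have := sqrt5_sqr; lra.
Qed.

Lemma cos_mod5 d : cos (INR d * angle72) =
  nth 0 [:: 1; cos72; cos144; cos144; cos72] (d %% 5).
Proof.
rewrite {1}(divn_eq d 5) plus_INR mult_INR.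
rewrite (_ : _ * angle72 = INR (d %% 5) * angle72 + 2 * INR (d %/ 5) * PI); last by rewrite /angle72 /=; field.
rewrite cos_period.
have := ltn_pmod d (isT : (0 < 5)%N); case: (d %% 5)%N => [|[|[|[|[|?]]]]] //= _.
- by rewrite Rmult_0_l cos_0.
- by rewrite Rmult_1_l.
- by rewrite -cos_2PI_minus; congr cos; rewrite /angle72; field.
by rewrite -cos_2PI_minus; congr cos; rewrite /angle72; field.
Qed.

Lemma sin_mod5 d : sin (INR d * angle72) =
  nth 0 [:: 0; sin72; sin144; - sin144; - sin72] (d %% 5).
Proof.
rewrite {1}(divn_eq d 5) plus_INR mult_INR.
rewrite (_ : _ * angle72 = INR (d %% 5) * angle72 + 2 * INR (d %/ 5) * PI); last by rewrite /angle72 /=; field.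
rewrite sin_period.
have := ltn_pmod d (isT : (0 < 5)%N); case: (d %% 5)%N => [|[|[|[|[|?]]]]] //= _.
- by rewrite Rmult_0_l sin_0.
- by rewrite Rmult_1_l.
- by rewrite -sin_2PI_minus; congr sin; rewrite /angle72; field.
by rewrite -sin_2PI_minus; congr sin; rewrite /angle72; field.
Qed.

Lemma INR_double d x : INR d * (2 * x) = INR (2 * d) * x.
Proof. by rewrite mult_INR /=; ring. Qed.

Ltac residues5 d :=
  have := sqrt5_sqr; have := sin72_sqr; have := sin144_sqr; have := sin72_mul_sin144;
  rewrite ?INR_double ?cos_mod5 ?sin_mod5 ?cos72E ?cos144E /ev /od -(modnMmr 2 d);
  have := ltn_pmod d (isT : (0 < 5)%N);
  case: (d %% 5)%N => [|[|[|[|[|?]]]]] //= *; rewrite ?cos72E ?cos144E; try lra.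

(** Discrete Fourier expansion on Z/5; the constant 2/5 is the mean value. It reduces the residue
    functions to frequencies whose series are known. *)
Lemma ev1E d : ev 1 d = 2 / 5 + 4 / 5 * (cos72 * cos (INR d * angle72) + cos144 * cos (INR d * (2 * angle72))).
Proof. by residues5 d. Qed.

Lemma ev2E d : ev 2 d = 2 / 5 + 4 / 5 * (cos144 * cos (INR d * angle72) + cos72 * cos (INR d * (2 * angle72))).
Proof. by residues5 d. Qed.

Lemma od1E d : od 1 d = 4 / 5 * (sin72 * sin (INR d * angle72) + sin144 * sin (INR d * (2 * angle72))).
Proof. by residues5 d. Qed.

Lemma od2E d : od 2 d = 4 / 5 * (sin144 * sin (INR d * angle72) - sin72 * sin (INR d * (2 * angle72))).
Proof. by residues5 d. Qed.

Lemma chi4E d : chi4 d = sin (INR d * (PI / 2)).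
Proof.
rewrite {2}(divn_eq d 4) plus_INR mult_INR.
rewrite (_ : _ * (PI / 2) = INR (d %% 4) * (PI / 2) + 2 * INR (d %/ 4) * PI); last by rewrite /=; field.
rewrite sin_period /chi4; have := ltn_pmod d (isT : (0 < 4)%N).
case: (d %% 4)%N => [|[|[|[|?]]]] //= _.
- by rewrite Rmult_0_l sin_0.
- by rewrite Rmult_1_l sin_PI2.
- by rewrite (_ : _ * _ = PI) ?sin_PI //; field.
by rewrite (_ : _ * _ = 3 * (PI / 2)) ?sin_3PI2 //; ring.
Qed.

Lemma sign_cos d x : (-1) ^ d * cos (INR d * x) = cos (INR d * (PI - x)).
Proof. by rewrite (Rmult_minus_distr_l (INR d)) cos_minus sin_INR_PI cos_INR_PI; ring. Qed.

Lemma sign_sin d x : (-1) ^ d * sin (INR d * x) = - sin (INR d * (PI - x)).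
Proof. by rewrite (Rmult_minus_distr_l (INR d)) sin_minus sin_INR_PI cos_INR_PI; ring. Qed.

Lemma chi4_cos d x : chi4 d * cos (INR d * x) =
  / 2 * (sin (INR d * (PI / 2 + x)) + sin (INR d * (PI / 2 - x))).
Proof. by rewrite chi4E (Rmult_plus_distr_l (INR d)) (Rmult_minus_distr_l (INR d)) sin_plus sin_minus; field. Qed.

Lemma chi4_sin d x : chi4 d * sin (INR d * x) =
  / 2 * (cos (INR d * (PI / 2 - x)) - cos (INR d * (PI / 2 + x))).
Proof. by rewrite chi4E (Rmult_plus_distr_l (INR d)) (Rmult_minus_distr_l (INR d)) cos_plus cos_minus; field. Qed.

Lemma sin_reflect d x : sin (INR d * x) = - sin (INR d * (2 * PI - x)).
Proof.
rewrite -sin_neg -(sin_period (- _) d); congr sin; ring.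
Qed.

Lemma cos_reflect d x : cos (INR d * x) = cos (INR d * (2 * PI - x)).
Proof.
rewrite -[RHS]cos_neg -(cos_period (- _) d); congr cos; ring.
Qed.

Lemma sin_oppr d x : sin (INR d * - x) = - sin (INR d * x).
Proof. by rewrite -sin_neg; congr sin; ring. Qed.

Lemma cos_oppr d x : cos (INR d * - x) = cos (INR d * x).
Proof. by rewrite -[RHS]cos_neg; congr cos; ring. Qed.

Definition angle18 k := INR k * (PI / 10).

Lemma angle18_range k : (0 < k <= 10)%N -> 0 < angle18 k <= PI.
Proof.
move=> /andP[/ltP/lt_INR /= k0 /leP/le_INR /= k10]; have := PI_RGT_0; rewrite /angle18; nra.
Qed.

Ltac angle_field := rewrite /angle18 /angle72 /=; field.

(** chi_4(d) = sin (d pi / 2) shifts each frequency by a right angle, so 90, 162, 18, 54 and 126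
    degrees occur, up to sign and reflection into the range of the sine series. The coefficients are
    free so that both even residue functions are covered. *)
Lemma chi4_ev_rate x y : 
  lseries (fun d => chi4 d * (2 / 5 + 4 / 5 * (x * cos (INR d * angle72) + y * cos (INR d * (2 * angle72)))))
    (PI / 10 + PI / 5 * (x - y)).
Proof.
have S k (hk : (0 < k <= 10)%N) := lseries_sin (angle18_range hk).
apply: lseries_ext (lseriesD (lseriesZ (2 / 5) (S 5%N isT))
  (lseriesD (lseriesZ (2 / 5 * x) (lseriesD (S 9%N isT) (S 1%N isT)))
     (lseriesZ (- (2 / 5) * y) (lseriesD (S 7%N isT) (S 3%N isT))))).
  move=> d; rewrite !Rmult_plus_distr_l.
  rewrite (_ : chi4 d * (2 / 5) = 2 / 5 * chi4 d); last by ring.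
  rewrite (_ : chi4 d * (4 / 5 * (x * cos (INR d * angle72))) = 4 / 5 * x * (chi4 d * cos (INR d * angle72))); last by ring.
  rewrite (_ : chi4 d * (4 / 5 * (y * cos (INR d * (2 * angle72)))) = 4 / 5 * y * (chi4 d * cos (INR d * (2 * angle72)))); last by ring.
  rewrite !chi4_cos chi4E.
  rewrite (_ : PI / 2 + angle72 = angle18 9); last by angle_field.
  rewrite (_ : PI / 2 - angle72 = angle18 1); last by angle_field.
  rewrite (_ : PI / 2 - 2 * angle72 = - angle18 3); last by angle_field.
  rewrite (sin_reflect d (PI / 2 + 2 * angle72)) (_ : 2 * PI - (PI / 2 + 2 * angle72) = angle18 7); last by angle_field.
  rewrite (_ : PI / 2 = angle18 5); last by angle_field.
  by rewrite sin_oppr; field.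
by rewrite /angle18 /=; field.
Qed.

(** The logarithm of the chord |1 - exp(i t)|, that is, minus the value of the cosine series at this
    angle. *)
Definition log_chord k := ln (2 * sin (angle18 k / 2)).

Lemma chi4_od_rate x y :
  lseries (fun d => chi4 d * (4 / 5 * (x * sin (INR d * angle72) + y * sin (INR d * (2 * angle72)))))
    (2 / 5 * (x * (log_chord 9 - log_chord 1) + y * (log_chord 7 - log_chord 3))).
Proof.
have S k (hk : (0 < k <= 10)%N) := lseries_cos (angle18_range hk).
apply: lseries_ext (lseriesD 
  (lseriesZ (2 / 5 * x) (lseriesD (S 1%N isT) (lseriesZ (- 1) (S 9%N isT))))
  (lseriesZ (2 / 5 * y) (lseriesD (S 3%N isT) (lseriesZ (- 1) (S 7%N isT))))).
  move=> d; rewrite !Rmult_plus_distr_l.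
  rewrite (_ : chi4 d * (4 / 5 * (x * sin (INR d * angle72))) = 4 / 5 * x * (chi4 d * sin (INR d * angle72))); last by ring.
  rewrite (_ : chi4 d * (4 / 5 * (y * sin (INR d * (2 * angle72)))) = 4 / 5 * y * (chi4 d * sin (INR d * (2 * angle72)))); last by ring.
  rewrite !chi4_sin.
  rewrite (_ : PI / 2 + angle72 = angle18 9); last by angle_field.
  rewrite (_ : PI / 2 - angle72 = angle18 1); last by angle_field.
  rewrite (_ : PI / 2 - 2 * angle72 = - angle18 3); last by angle_field.
  rewrite (cos_reflect d (PI / 2 + 2 * angle72)) (_ : 2 * PI - (PI / 2 + 2 * angle72) = angle18 7); last by angle_field.
  by rewrite cos_oppr; field.
by rewrite -!/(log_chord _); ring.
Qed.

(** The factor (-1)^d turns the angle x into pi - x, here 108 and 36 degrees; the constant mode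
    leaves the alternating harmonic series. *)
Lemma sign_ev_rate x y :
  lseries (fun d => (-1) ^ d * (2 / 5 + 4 / 5 * (x * cos (INR d * angle72) + y * cos (INR d * (2 * angle72)))))
    (- (2 / 5) * ln 2 - 4 / 5 * (x * log_chord 6 + y * log_chord 2)).
Proof.
have S k (hk : (0 < k <= 10)%N) := lseries_cos (angle18_range hk).
apply: lseries_ext (lseriesD (lseriesZ (2 / 5) alternating_harmonic_rate)
  (lseriesD (lseriesZ (4 / 5 * x) (S 6%N isT)) (lseriesZ (4 / 5 * y) (S 2%N isT)))).
  move=> d; rewrite !Rmult_plus_distr_l.
  rewrite (_ : (-1) ^ d * (4 / 5 * (x * cos (INR d * angle72))) = 4 / 5 * x * ((-1) ^ d * cos (INR d * angle72))); last by ring.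
  rewrite (_ : (-1) ^ d * (4 / 5 * (y * cos (INR d * (2 * angle72)))) = 4 / 5 * y * ((-1) ^ d * cos (INR d * (2 * angle72)))); last by ring.
  rewrite !sign_cos.
  rewrite (_ : PI - angle72 = angle18 6); last by angle_field.
  rewrite (_ : PI - 2 * angle72 = angle18 2); last by angle_field.
  by ring.
by rewrite -!/(log_chord _); ring.
Qed.

Lemma sign_od_rate x y :
  lseries (fun d => (-1) ^ d * (4 / 5 * (x * sin (INR d * angle72) + y * sin (INR d * (2 * angle72)))))
    (- (4 * PI / 25) * (x + 2 * y)).
Proof.
have S k (hk : (0 < k <= 10)%N) := lseries_sin (angle18_range hk).
apply: lseries_ext (lseriesD (lseriesZ (- (4 / 5) * x) (S 6%N isT)) (lseriesZ (- (4 / 5) * y) (S 2%N isT))).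
  move=> d; rewrite !Rmult_plus_distr_l.
  rewrite (_ : (-1) ^ d * (4 / 5 * (x * sin (INR d * angle72))) = 4 / 5 * x * ((-1) ^ d * sin (INR d * angle72))); last by ring.
  rewrite (_ : (-1) ^ d * (4 / 5 * (y * sin (INR d * (2 * angle72)))) = 4 / 5 * y * ((-1) ^ d * sin (INR d * (2 * angle72)))); last by ring.
  rewrite !sign_sin.
  rewrite (_ : PI - angle72 = angle18 6); last by angle_field.
  rewrite (_ : PI - 2 * angle72 = angle18 2); last by angle_field.
  by ring.
by rewrite /angle18 /=; field.
Qed.

(** * Closed forms of the logarithms *)

Lemma sin_angle18_half6 : 2 * sin (angle18 6 / 2) = (sqrt 5 + 1) / 2.
Proof.
have -> : angle18 6 / 2 = PI / 2 - angle72 / 2 by angle_field.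
rewrite sin_shift -cos_neg -[X in _ * X]Ropp_involutive -neg_cos.
rewrite (_ : - (angle72 / 2) + PI = 2 * angle72); last by angle_field.
by rewrite -/cos144 cos144E; field.
Qed.

Lemma sin_angle18_half2 : sin (angle18 2 / 2) = cos72.
Proof. by rewrite /cos72 -sin_shift; congr sin; angle_field. Qed.

Lemma log_chord6 : log_chord 6 = ln ((sqrt 5 + 1) / 2).
Proof. by rewrite /log_chord sin_angle18_half6. Qed.

(** The two chords are the golden ratio and its inverse. *)
Lemma log_chord2 : log_chord 2 = - log_chord 6.
Proof.
have r0 := sqrt_lt_R0 5 ltac:(lra).
rewrite log_chord6 -ln_Rinv; last by lra.
rewrite /log_chord sin_angle18_half2 cos72E; congr ln; apply: (Rmult_eq_reg_r ((sqrt 5 + 1) / 2)); last by lra.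
by rewrite Rinv_l; [have := sqrt5_sqr; lra|lra].
Qed.

(** The argument on the right is the tangent of 9 degrees, computed by tan x = (1 - cos 2x) / sin 2x
    from the sine and cosine of 72 degrees. *)
Lemma log_chord9_sub1 : log_chord 9 - log_chord 1 = - ln (sqrt 5 + 1 - sqrt (5 + 2 * sqrt 5)).
Proof.
have pi := PI_RGT_0; have r0 := sqrt_lt_R0 5 ltac:(lra); have r5 := sqrt5_sqr.
pose x := PI / 20.
have sx : 0 < sin x by apply: sin_gt_0; rewrite /x; lra.
have cx : 0 < cos x by apply: cos_gt_0; rewrite /x; lra.
have c1p := cos72_gt0; have s1p := sin72_gt0.
have q1 : 2 * sin x * cos x = cos72 by rewrite -sin_2a -sin_angle18_half2; congr sin; rewrite /x; angle_field.
have q2 : 1 - 2 * sin x * sin x = sin72.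
  by rewrite -cos_2a_sin /sin72 -cos_shift; congr cos; rewrite /x; angle_field.
have E : sin x / cos x = sqrt 5 + 1 - sqrt (5 + 2 * sqrt 5).
  have -> : sin x / cos x = (1 - sin72) / cos72.
    by rewrite -q1 -q2; field; lra.
  have i1 : / cos72 = sqrt 5 + 1.
    by apply: (Rmult_eq_reg_r cos72); [rewrite Rinv_l; [rewrite cos72E|]|]; lra.
  have i2 : sin72 / cos72 = sqrt (5 + 2 * sqrt 5).
    apply: esym; apply: sqrt_lem_1; first by lra.
      by apply: Rmult_le_pos; [lra|left; apply: Rinv_0_lt_compat].
    rewrite (_ : sin72 / cos72 * (sin72 / cos72) = sin72 * sin72 * (/ cos72 * / cos72)); last by field; lra.
    by rewrite i1 sin72_sqr; nra.
  by rewrite (_ : (1 - sin72) / cos72 = / cos72 - sin72 / cos72); [rewrite i1 i2|field; lra].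
have h9 : sin (angle18 9 / 2) = cos x by rewrite -sin_shift; congr sin; rewrite /x; angle_field.
have h1 : sin (angle18 1 / 2) = sin x by congr sin; rewrite /x; angle_field.
rewrite -E ln_div // /log_chord h9 h1 !ln_mult; lra.
Qed.

Lemma class_sum_value :
  - / 2 * ((PI / 10 + PI / 5 * (cos72 - cos144)) * (- (2 / 5) * ln 2 - 4 / 5 * (cos72 * log_chord 6 + cos144 * log_chord 2)) +
           (PI / 10 + PI / 5 * (cos144 - cos72)) * (- (2 / 5) * ln 2 - 4 / 5 * (cos144 * log_chord 6 + cos72 * log_chord 2)) +
           2 / 5 * (sin72 * (log_chord 9 - log_chord 1) + sin144 * (log_chord 7 - log_chord 3)) * (- (4 * PI / 25) * (sin72 + 2 * sin144)) -
           2 / 5 * (sin144 * (log_chord 9 - log_chord 1) + - sin72 * (log_chord 7 - log_chord 3)) * (- (4 * PI / 25) * (sin144 + 2 * - sin72))) =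
  - (PI / (5 * sqrt 5)) * ln (sqrt 5 + 1 - sqrt (5 + 2 * sqrt 5)) + PI / 25 * ln (11 + 5 * sqrt 5).
Proof.
have r0 := sqrt_lt_R0 5 ltac:(lra); have r5 := sqrt5_sqr.
(* 11 + 5 sqrt 5 is twice the fifth power of the golden ratio. *)
have -> : ln (11 + 5 * sqrt 5) = ln 2 + 5 * log_chord 6.
  have p0 : 0 < (sqrt 5 + 1) / 2 by lra.
  have E5 := Rpower.ln_pow _ p0 5; rewrite (_ : INR 5 = 5) in E5; last by simpl; lra.
  rewrite log_chord6 -E5 -ln_mult; [|lra|exact: pow_lt].
  congr ln; have p2 : ((sqrt 5 + 1) / 2) ^ 2 = (sqrt 5 + 3) / 2 by nra.
  rewrite (_ : _ ^ 5 = ((sqrt 5 + 1) / 2) ^ 2 * ((sqrt 5 + 1) / 2) ^ 2 * ((sqrt 5 + 1) / 2)); last by ring.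
  by rewrite p2; nra.
have -> : ln (sqrt 5 + 1 - sqrt (5 + 2 * sqrt 5)) = - (log_chord 9 - log_chord 1) by rewrite log_chord9_sub1; ring.
rewrite log_chord2; move: (log_chord 9 - log_chord 1) (log_chord 7 - log_chord 3) (log_chord 6) (ln 2) => lam mu p q.
have -> : PI / (5 * sqrt 5) = PI * sqrt 5 / 25.
  apply: (Rmult_eq_reg_r (5 * sqrt 5)); last by lra.
  transitivity (PI * (sqrt 5 * sqrt 5) / 5); last by field.
  by rewrite r5; field; lra.
(* The logarithm [mu], which is absent from the result, cancels between the two odd products. *)
have T : (sin72 * lam + sin144 * mu) * (sin72 + 2 * sin144) - (sin144 * lam + - sin72 * mu) * (sin144 + 2 * - sin72) = 5 * sqrt 5 / 4 * lam.
  transitivity ((sin72 * sin72 - sin144 * sin144 + 4 * (sin72 * sin144)) * lam + (2 * (sin72 * sin144) - 2 * (sin72 * sin72) + 2 * (sin144 * sin144)) * mu).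
    by ring.
  by rewrite sin72_sqr sin144_sqr sin72_mul_sin144; field.
transitivity (- / 2 * ((PI / 10 + PI / 5 * (cos72 - cos144)) * (- (2 / 5) * q - 4 / 5 * (cos72 * p + cos144 * - p)) +
           (PI / 10 + PI / 5 * (cos144 - cos72)) * (- (2 / 5) * q - 4 / 5 * (cos144 * p + cos72 * - p))
   - 8 * PI / 125 * (5 * sqrt 5 / 4 * lam))).
  by rewrite -T; field.
rewrite cos72E cos144E.
transitivity (PI / 25 * (sqrt 5 * sqrt 5 * p + q) + PI * sqrt 5 / 25 * lam); first by field.
by rewrite r5; field.
Qed.

(** * Summation by rows *)

Definition class_sum (X : nat) : R :=
  \big[Rplus/R0]_(1 <= k < X.+1 | (k %% 5 == 1)%N) (- ((-1) ^ k / INR k) * chi4_sum k).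

Definition hyp_sum (u v : nat -> R) (X : nat) : R :=
  \big[Rplus/R0]_(1 <= d < X.+1)
    \big[Rplus/R0]_(1 <= e < X.+1 | (d * e <= X)%N) (u d * v e).

(** chi_4 vanishes at even d, so the sign depends on e alone; this makes the summand a product of a
    function of d and a function of e. *)
Lemma chi4_sign d e : chi4 d * (-1) ^ (d * e) = chi4 d * (-1) ^ e.
Proof.
rewrite pow_mult; case: (boolP (odd d)) => od.
  suff -> : (-1) ^ d = -1 by [].
  by rewrite -[d]odd_double_half od -muln2 add1n mulnC /= pow_1_even; ring.
suff -> : chi4 d = 0 by rewrite !Rmult_0_l.
have : (d %% 4 = 0 \/ d %% 4 = 2)%N by lia.
by rewrite /chi4 => -[] ->.
Qed.

Definition chi4_ev j d := chi4 d * ev j d / INR d.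
Definition chi4_od j d := chi4 d * od j d / INR d.
Definition sign_ev j e := (-1) ^ e * ev j e / INR e.
Definition sign_od j e := (-1) ^ e * od j e / INR e.

Lemma sum_half_comb (T : Type) (s : seq T) (P : pred T) (F1 F2 F3 F4 : T -> R) :
  \big[Rplus/R0]_(i <- s | P i) (- / 2 * (F1 i + F2 i + F3 i - F4 i)) =
  - / 2 * (\big[Rplus/R0]_(i <- s | P i) F1 i + \big[Rplus/R0]_(i <- s | P i) F2 i +
           \big[Rplus/R0]_(i <- s | P i) F3 i - \big[Rplus/R0]_(i <- s | P i) F4 i).
Proof.
elim: s => [|i s IH]; first by rewrite !big_nil; ring.
by rewrite !big_cons IH; case: (P i) => //; ring.
Qed.

Lemma class_sumE X : class_sum X =
  - / 2 * (hyp_sum (chi4_ev 1) (sign_ev 1) X + hyp_sum (chi4_ev 2) (sign_ev 2) X +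
           hyp_sum (chi4_od 1) (sign_od 1) X - hyp_sum (chi4_od 2) (sign_od 2) X).
Proof.
pose G d e := - (chi4 d * (-1) ^ e / (INR d * INR e)).
transitivity (\big[Rplus/R0]_(1 <= k < X.+1 | (k %% 5 == 1)%N)
     (\big[Rplus/R0]_(d <- divisors k) G d (k %/ d)%N)).
  rewrite /class_sum big_nat_cond [RHS]big_nat_cond; apply: eq_bigr => k /andP[/andP[k0 _] _].
  rewrite /chi4_sum big_distrr big_seq [RHS]big_seq; apply: eq_bigr => d.
  rewrite -dvdn_divisors // => /dvdnP[e kE] /=.
  have d0 : (0 < d)%N by case: d kE k0 => // ->; rewrite muln0.
  have e0 : (0 < e)%N by case: e kE k0 => // ->.
  have dr : INR d <> 0 by apply: not_0_INR; lia.
  have er : INR e <> 0 by apply: not_0_INR; lia.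
  rewrite kE mulnK // /G -chi4_sign mulnC mult_INR; field; lra.
rewrite (sum_divisors_pairs X (fun k => k %% 5 == 1)%N G).
rewrite /hyp_sum -sum_half_comb; apply: eq_bigr => d _.
rewrite -sum_half_comb big_mkcondr; apply: eq_bigr => e _.
have := mul_eq1_mod5 d e; rewrite /G /chi4_ev /chi4_od /sign_ev /sign_od /Rdiv Rinv_mult.
move: (/ INR d) (/ INR e) (chi4 d) ((-1) ^ e) => x y z t E.
transitivity (- (z * t * (x * y)) * (if (d * e %% 5 == 1)%N then 1 else 0)); first by case: ifP => _; ring.
by rewrite E; ring.
Qed.

Lemma class_sum_limit : is_lim_seq (fun Y => class_sum (Y * Y))
  (- (PI / (5 * sqrt 5)) * ln (sqrt 5 + 1 - sqrt (5 + 2 * sqrt 5))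
        + PI / 25 * ln (11 + 5 * sqrt 5)).
Proof.
rewrite -class_sum_value; apply: is_lim_seq_ext => [Y|]; first by rewrite class_sumE.
apply: (is_lim_seq_scal_l _ _ (Finite _)).
have a1 := lseries_ext (fun d => congr1 (Rmult (chi4 d)) (esym (ev1E d))) erefl (chi4_ev_rate cos72 cos144).
have a2 := lseries_ext (fun d => congr1 (Rmult (chi4 d)) (esym (ev2E d))) erefl (chi4_ev_rate cos144 cos72).
have a3 := lseries_ext (fun d => congr1 (Rmult (chi4 d)) (esym (od1E d))) erefl (chi4_od_rate sin72 sin144).
have od2E' d : 4 / 5 * (sin144 * sin (INR d * angle72) + - sin72 * sin (INR d * (2 * angle72))) = od 2 d by rewrite od2E; ring.
have a4 := lseries_ext (fun d => congr1 (Rmult (chi4 d)) (od2E' d)) erefl (chi4_od_rate sin144 (- sin72)).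
have b1 := lseries_ext (fun d => congr1 (Rmult ((-1) ^ d)) (esym (ev1E d))) erefl (sign_ev_rate cos72 cos144).
have b2 := lseries_ext (fun d => congr1 (Rmult ((-1) ^ d)) (esym (ev2E d))) erefl (sign_ev_rate cos144 cos72).
have b3 := lseries_ext (fun d => congr1 (Rmult ((-1) ^ d)) (esym (od1E d))) erefl (sign_od_rate sin72 sin144).
have b4 := lseries_ext (fun d => congr1 (Rmult ((-1) ^ d)) (od2E' d)) erefl (sign_od_rate sin144 (- sin72)).
apply: is_lim_seq_minus'; last exact: hyperbola_sum_limit a4 b4.
apply: is_lim_seq_plus'; last exact: hyperbola_sum_limit a3 b3.
by apply: is_lim_seq_plus'; [exact: hyperbola_sum_limit a1 b1|exact: hyperbola_sum_limit a2 b2].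
Qed.

(** * Truncation of alternating series *)

Lemma alternating_partial (f : nat -> R) K L : (forall k, 0 <= f k.+1 <= f k) ->
  Rabs (sum_n (fun k => (-1) ^ k * f k) (K + L) -
        \big[Rplus/R0]_(0 <= k < K) ((-1) ^ k * f k)) <= f K.
Proof.
move=> hf; have sumE n : sum_n (fun k => (-1) ^ k * f k) n = \big[Rplus/R0]_(0 <= k < n.+1) ((-1) ^ k * f k).
  elim: n => [|n IH]; first by rewrite sum_O big_nat1.
  by rewrite sum_Sn IH [RHS]big_nat_recr.
(* Removing the first term negates the rest and moves the start to K + 1, so the induction must
   allow every K. *)
have tail : forall L K, 0 <= \big[Rplus/R0]_(0 <= j < L.+1) ((-1) ^ j * f (K + j)%N) <= f K.
  elim=> [|M IH] k; first by rewrite big_nat1 addn0 /=; have := hf k; lra.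
  rewrite big_nat_recl // addn0.
  have -> : \big[Rplus/R0]_(0 <= i < M.+1) ((-1) ^ i.+1 * f (k + i.+1)%N) =
     - \big[Rplus/R0]_(0 <= j < M.+1) ((-1) ^ j * f (k.+1 + j)%N).
    rewrite -[RHS]Rmult_1_l -Ropp_mult_distr_r Ropp_mult_distr_l big_distrr.
    by apply: eq_bigr => j _; rewrite addnS addSn /=; ring.
  have := IH k.+1; have := hf k; rewrite /=; lra.
rewrite sumE (@big_cat_nat _ _ _ K) //=; last by lia.
rewrite -{2}[K]add0n big_addn (_ : (K + L).+1 - K = L.+1)%N; last by lia.
have -> : \big[Rplus/R0]_(0 <= i < L.+1) ((-1) ^ (i + K) * f (i + K)%N) =
   (-1) ^ K * \big[Rplus/R0]_(0 <= j < L.+1) ((-1) ^ j * f (K + j)%N).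
  by rewrite big_distrr; apply: eq_bigr => j _; rewrite pow_add addnC /=; ring.
have := tail L K; move: (\big[_/_]_(0 <= j < L.+1) _) (\big[_/_]_(0 <= j < K) _) => x y xf.
rewrite (_ : y + _ - y = (-1) ^ K * x); last by ring.
by rewrite Rabs_mult pow_1_abs Rmult_1_l Rabs_pos_eq; lra.
Qed.

Lemma alternating_tail (f : nat -> R) K : (forall k, 0 <= f k.+1 <= f k) ->
  ex_series (fun k => (-1) ^ k * f k) ->
  Rabs (Series (fun k => (-1) ^ k * f k) - \big[Rplus/R0]_(0 <= k < K) ((-1) ^ k * f k)) <= f K.
Proof.
move=> hf /Series_correct hs; set S := Series _; set y := \big[_/_]_(_ <= _ < _) _.
have lim : is_lim_seq (fun L => Rabs (sum_n (fun k => (-1) ^ k * f k) (K + L) - y)) (Rabs (S - y)).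
  apply: (is_lim_seq_abs _ (Finite _)); apply: is_lim_seq_minus'; last exact: is_lim_seq_const.
  apply: (is_lim_seq_ext (fun L => sum_n (fun k => (-1) ^ k * f k) (L + K))) => [L|].
    by rewrite addnC.
  exact: (proj1 (is_lim_seq_incr_n (sum_n (fun k => (-1) ^ k * f k)) K (Finite S)) hs).
apply: (is_lim_seq_le _ _ (Finite _) (Finite (f K)) _ lim (is_lim_seq_const _)) => L.
exact: alternating_partial.
Qed.

(** [P] holds on an initial segment, so the filtered sum is an honest partial sum and the error is
    at most the first omitted term. This is the form in which a disk cuts a half row. *)
Lemma alternating_truncated (f : nat -> R) (P : pred nat) M delta :
  (forall k, 0 <= f k.+1 <= f k) -> ex_series (fun k => (-1) ^ k * f k) ->
  (forall k, P k.+1 -> P k) -> ~~ P M -> (forall k, ~~ P k -> f k <= delta) ->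
  Rabs (Series (fun k => (-1) ^ k * f k) - \big[Rplus/R0]_(0 <= k < M | P k) ((-1) ^ k * f k)) <= delta.
Proof.
move=> hf hs Pd PM Pf.
have exK : exists k, ~~ P k by exists M.
case: (ex_minnP exK) => K PK Kmin.
have KM : (K <= M)%N by apply: Kmin.
have PE k : P k = (k < K)%N.
  apply/idP/idP => [Pk|kK]; last by apply: contraTT kK => /Kmin; rewrite -leqNgt.
  rewrite ltnNge; apply/negP => Kk; case/negP: PK.
  have Pm : forall j, P (K + j)%N -> P K by elim=> [|j IH]; rewrite ?addn0 // addnS => /Pd.
  by apply: (Pm (k - K)%N); rewrite subnKC.
have -> : \big[Rplus/R0]_(0 <= k < M | P k) ((-1) ^ k * f k) = \big[Rplus/R0]_(0 <= k < K) ((-1) ^ k * f k).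
  by rewrite (@big_nat_widen _ _ _ 0 K M) //; apply: eq_bigl => k; rewrite PE.
by apply: Rle_trans (alternating_tail K hf hs) _; apply: Pf.
Qed.

Definition row_f (n : Z) (k : nat) : R := / ((5 * INR k) ^ 2 + (5 * IZR n + 1) ^ 2).

Lemma shifted_sqr_ge1 n : 1 <= (5 * IZR n + 1) ^ 2.
Proof.
rewrite -mult_IZR -plus_IZR pow_IZR; apply: IZR_le.
by rewrite Z.pow_2_r; nia.
Qed.

Lemma row_f_gt0 n k : 0 < row_f n k.
Proof.
by apply: Rinv_0_lt_compat; have := shifted_sqr_ge1 n; have := pow2_ge_0 (5 * INR k); lra.
Qed.

Lemma row_f_decr n k : 0 <= row_f n k.+1 <= row_f n k.
Proof.
split; first exact: Rlt_le (row_f_gt0 n k.+1).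
have := shifted_sqr_ge1 n; have := pos_INR k => k0 h; apply: Rinv_le_contravar.
  by have := pow2_ge_0 (5 * INR k); lra.
by apply: Rplus_le_compat_r; apply: pow_incr; rewrite S_INR; lra.
Qed.

Lemma ex_series_row_f n : ex_series (row_f n).
Proof.
(* The telescoping majorant is 2 / ((k + 1) (k + 2)); the factor 2 makes it equal to 1 at k = 0, the
   largest possible value of the first term. *)
apply: (@ex_series_le _ _ _ (fun k => 2 * (/ INR k.+1 - / INR k.+2))) => [k|].
  rewrite /norm /= /abs /= Rabs_pos_eq; last exact: Rlt_le (row_f_gt0 n k).
  have k0 := pos_INR k.
  rewrite -/(INR k.+1) -/(INR k.+2) !S_INR.
  have -> : 2 * (/ (INR k + 1) - / (INR k + 1 + 1)) = / ((INR k + 1) * (INR k + 2) / 2) by field; lra.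
  apply: Rinv_le_contravar; first by nra.
  have kk : INR k <= INR k * INR k.
    by rewrite -mult_INR; apply: le_INR; case: (k) => // j; nia.
  by have := shifted_sqr_ge1 n; nra.
apply: (ex_series_scal_l 2 (fun k => / INR k.+1 - / INR k.+2)).
suff H : is_lim_seq (sum_n (fun k => / INR k.+1 - / INR k.+2)) 1 by exists 1; exact: H.
apply: (is_lim_seq_ext (fun k => 1 - / INR k.+2)).
  elim=> [|k IH]; first by rewrite sum_O Rinv_1.
  by rewrite sum_Sn -IH /plus /=; ring.
rewrite -[X in is_lim_seq _ (Finite X)]Rminus_0_r.
apply: is_lim_seq_minus'; first exact: is_lim_seq_const.
apply: (is_lim_seq_inv (fun k => INR k.+2) p_infty) => //.
apply: (proj1 (is_lim_seq_incr_1 (fun k => INR k.+1) p_infty)).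
exact: (proj1 (is_lim_seq_incr_1 INR p_infty) is_lim_seq_INR).
Qed.

Lemma powerRZ_m1D a b : powerRZ (-1) (a + b) = powerRZ (-1) a * powerRZ (-1) b.
Proof. by apply: powerRZ_add; lra. Qed.

Lemma powerRZ_m1_nat k : powerRZ (-1) (Z.of_nat k) = (-1) ^ k.
Proof. by rewrite -pow_powerRZ. Qed.

Lemma powerRZ_m1_neg k : powerRZ (-1) (- Z.of_nat k) = (-1) ^ k.
Proof.
have := powerRZ_m1D (Z.of_nat k) (- Z.of_nat k); rewrite Z.add_opp_diag_r powerRZ_m1_nat /=.
by case: (Nat.Even_or_Odd k) => -[j ->]; rewrite ?Nat.add_1_r ?pow_1_odd ?pow_1_even; lra.
Qed.

Lemma term_nat n k : term (Z.of_nat k) n = powerRZ (-1) n * ((-1) ^ k * row_f n k).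
Proof. by rewrite /term powerRZ_m1D powerRZ_m1_nat /row_f /Rdiv -INR_IZR_INZ; ring. Qed.

Lemma term_neg n k :
  term (- Z.of_nat k.+1) n = - powerRZ (-1) n * ((-1) ^ k * row_f n k.+1).
Proof.
rewrite /term powerRZ_m1D powerRZ_m1_neg /row_f /Rdiv opp_IZR -INR_IZR_INZ.
rewrite (_ : (5 * - INR k.+1) ^ 2 = (5 * INR k.+1) ^ 2); last by ring.
by rewrite [(-1) ^ k.+1]/=; ring.
Qed.

Lemma powerRZ_m1_abs n : Rabs (powerRZ (-1) n) = 1.
Proof.
case: n => [|p|p] /=; rewrite ?Rabs_R1 ?pow_1_abs //.
by rewrite Rabs_inv pow_1_abs Rinv_1.
Qed.

Lemma ex_Zseries_abs_term n : ex_Zseries_abs (fun m => term m n).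
Proof.
split.
  apply: ex_series_ext (ex_series_row_f n) => k.
  rewrite term_nat !Rabs_mult powerRZ_m1_abs pow_1_abs !Rmult_1_l Rabs_pos_eq //.
  exact: Rlt_le (row_f_gt0 n k).
apply: ex_series_ext (proj1 (ex_series_incr_1 _) (ex_series_row_f n)) => k.
rewrite term_neg !Rabs_mult Rabs_Ropp powerRZ_m1_abs pow_1_abs !Rmult_1_l Rabs_pos_eq //.
exact: Rlt_le (row_f_gt0 n k.+1).
Qed.

Lemma ex_series_alternating (f : nat -> R) : (forall k, 0 <= f k) -> ex_series f ->
  ex_series (fun k => (-1) ^ k * f k).
Proof.
move=> f0 hf; apply: ex_series_Rabs; apply: ex_series_ext hf => k.
by rewrite Rabs_mult pow_1_abs Rmult_1_l Rabs_pos_eq.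
Qed.

Definition column_indices (M : nat) : seq Z :=
  [seq Z.of_nat k | k <- seq.iota 0 M] ++ [seq (- Z.of_nat k.+1)%Z | k <- seq.iota 0 M].

Definition in_disk (X : nat) (n m : Z) : bool :=
  (sqnorm (5 * m, 5 * n + 1) <=? Z.of_nat X)%Z.

Lemma row_f_sqnorm n k m : (m * m = Z.of_nat k * Z.of_nat k)%Z ->
  row_f n k = / IZR (sqnorm (5 * m, 5 * n + 1)%Z).
Proof.
move=> mk; rewrite /row_f /sqnorm /=; congr (/ _).
rewrite (_ : (5 * m * (5 * m) + (5 * n + 1) * (5 * n + 1) =
   (5 * Z.of_nat k) * (5 * Z.of_nat k) + (5 * n + 1) * (5 * n + 1))%Z); last by lia.
by rewrite plus_IZR !mult_IZR plus_IZR mult_IZR -INR_IZR_INZ /=; ring.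
Qed.

(** The halves m >= 0 and m < 0 are both alternating with decreasing terms, and the first omitted
    term of each has norm above [X]: the error is at most 1 / X on each side. *)
Lemma row_truncation n X : (0 < X)%N ->
  Rabs (Zseries (fun m => term m n) -
        \big[Rplus/R0]_(m <- column_indices X.+1 | in_disk X n m) term m n) <= 2 / INR X.
Proof.
move=> X0; have Xp : 0 < INR X by apply: lt_0_INR; apply/ltP.
have far k m : (m * m = Z.of_nat k * Z.of_nat k)%Z -> ~~ in_disk X n m -> row_f n k <= / INR X.
  move=> mk; rewrite /in_disk => /Z.leb_spec0 h; rewrite (row_f_sqnorm n mk).
  by apply: Rinv_le_contravar => //; rewrite INR_IZR_INZ; apply: IZR_le; lia.
rewrite big_cat !big_map /Zseries.
rewrite (Series_ext _ _ (term_nat n)) (Series_ext _ _ (term_neg n)) !Series_scal_l.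
under eq_bigr do rewrite term_nat; under [X in _ - (_ + X)]eq_bigr do rewrite term_neg.
rewrite -!big_distrr /=.
have A := alternating_truncated (f := row_f n) (P := fun k => in_disk X n (Z.of_nat k)) (M := X.+1) (delta := / INR X) (row_f_decr n).
have B := alternating_truncated (f := fun k => row_f n k.+1) (P := fun k => in_disk X n (- Z.of_nat k.+1)) (M := X.+1) (delta := / INR X) (fun k => row_f_decr n k.+1).
have {}A := A (ex_series_alternating (fun k => Rlt_le _ _ (row_f_gt0 n k)) (ex_series_row_f n)).
have {}B := B (ex_series_alternating (fun k => Rlt_le _ _ (row_f_gt0 n k.+1)) (proj1 (ex_series_incr_1 _) (ex_series_row_f n))).
have {}A : Rabs (Series (fun k => (-1) ^ k * row_f n k) -
    \big[Rplus/R0]_(0 <= k < X.+1 | in_disk X n (Z.of_nat k)) ((-1) ^ k * row_f n k)) <= / INR X.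
  apply: A => [k|| k]; rewrite /in_disk /sqnorm.
  - by move=> /Z.leb_le h; apply/Z.leb_le; cbn [fst snd] in *; nia.
  - by apply/negP => /Z.leb_le h; cbn [fst snd] in *; nia.
  by move=> h; apply: (far k (Z.of_nat k)).
have {}B : Rabs (Series (fun k => (-1) ^ k * row_f n k.+1) -
    \big[Rplus/R0]_(0 <= k < X.+1 | in_disk X n (- Z.of_nat k.+1)) ((-1) ^ k * row_f n k.+1)) <= / INR X.
  apply: B => [k|| k]; rewrite /in_disk /sqnorm.
  - by move=> /Z.leb_le h; apply/Z.leb_le; cbn [fst snd] in *; nia.
  - by apply/negP => /Z.leb_le h; cbn [fst snd] in *; nia.
  by move=> h; apply: (far k.+1 (- Z.of_nat k.+1)%Z) => //; lia.
move: A B; rewrite /index_iota subn0.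
move: (Series _) (Series _) (\big[_/_]_(_ <- _ | _) _) (\big[_/_]_(_ <- _ | _) _) => x1 x2 y1 y2 A B.
have sg := powerRZ_m1_abs n; move: (powerRZ (-1) n) sg => sg sg1.
rewrite (_ : _ - _ = sg * ((x2 - y2) - (x1 - y1))); last by ring.
rewrite Rabs_mult sg1 Rmult_1_l (_ : 2 / INR X = / INR X + / INR X); last by field; lra.
by split_Rabs; lra.
Qed.

Lemma powerRZ_m1_parity z : powerRZ (-1) z = if Z.even z then 1 else -1.
Proof.
have e2 n : (-1) ^ n = if Z.even (Z.of_nat n) then 1 else -1.
  elim: n => [//|n IH]; rewrite Nat2Z.inj_succ Z.even_succ -Z.negb_even /= IH.
  by case: (Z.even _) => /=; ring.
have [z0|z0] := Z.le_gt_cases 0 z.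
  by rewrite -(Z2Nat.id _ z0) powerRZ_m1_nat e2.
rewrite (_ : z = - Z.of_nat (Z.to_nat (- z)))%Z; last by lia.
by rewrite powerRZ_m1_neg e2 Z.even_opp.
Qed.

(** (5m)^2 + (5n+1)^2 has the parity of m + n + 1, whence the minus sign. *)
Lemma term_sqnorm m n : let q := Z.to_nat (sqnorm (5 * m, 5 * n + 1)%Z) in
  term m n = - ((-1) ^ q / INR q).
Proof.
move=> q; have q0 := @sqnorm_ge0 (5 * m, 5 * n + 1)%Z.
have qE : Z.of_nat q = sqnorm (5 * m, 5 * n + 1)%Z by rewrite /q Z2Nat.id.
rewrite -powerRZ_m1_nat INR_IZR_INZ qE /term /sqnorm /Rdiv Ropp_mult_distr_l; congr (_ * / _).
  cbn [fst snd]; rewrite !powerRZ_m1_parity !(Z.even_add, Z.even_mul).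
  by case: (Z.even m); case: (Z.even n) => /=; ring.
by cbn [fst snd]; rewrite !(plus_IZR, mult_IZR); ring.
Qed.

Definition row_indices (N : nat) : seq Z :=
  [seq (Z.of_nat k - Z.of_nat N)%Z | k <- index_iota 1 (2 * N)].

Definition disk_list (N X : nat) : seq (Z * Z) :=
  [seq z <- [seq (5 * m, 5 * n + 1)%Z | n <- row_indices N, m <- column_indices X.+1] |
     (sqnorm z <=? Z.of_nat X)%Z].

Lemma column_indices_uniq M : uniq (column_indices M).
Proof.
rewrite cat_uniq !map_inj_uniq ?iota_uniq ?andbT /=; try by move=> a b; lia.
by apply/hasPn => z /mapP[k _ ->]; apply/negP => /mapP[j _]; lia.
Qed.

Lemma row_indices_uniq N : uniq (row_indices N).
Proof. by rewrite map_inj_uniq ?iota_uniq // => a b; lia. Qed.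

Lemma disk_list_uniq N X : uniq (disk_list N X).
Proof.
apply: filter_uniq; apply: allpairs_uniq; rewrite ?row_indices_uniq ?column_indices_uniq //.
move=> [n m] [n' m'] _ _ E; have h1 : (5 * m = 5 * m')%Z := congr1 fst E.
have h2 : (5 * n + 1 = 5 * n' + 1)%Z := congr1 snd E.
by congr (_, _); lia.
Qed.

(* The radius 5N-4 is such that |5n+1| <= 5N-4 exactly when -N < n < N. *)
Lemma mem_disk_list N' z (N := N'.+1) (X := ((5 * N - 4) * (5 * N - 4))%N) :
  (z \in disk_list N X) = in_class z && (sqnorm z <=? Z.of_nat X)%Z.
Proof.
rewrite mem_filter andbC; case: (boolP (_ <=? _)%Z) => [zX|]; rewrite ?andbF // !andbT.
apply/allpairsP/andP => [[[n m] [_ _ ->]]|[]].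
  split; apply/Z.eqb_eq; cbn [fst snd].
  - by zmlia.
  - by zmlia.
case: z zX => a b /Z.leb_le; rewrite /sqnorm => zX /Z.eqb_eq a0 /Z.eqb_eq b1.
cbn [fst snd] in *.
have aE : a = (5 * (a / 5))%Z by zmlia.
have bE : b = (5 * (b / 5) + 1)%Z by zmlia.
exists (b / 5, a / 5)%Z; split; last by cbn [fst snd]; congr (_, _).
  have YX : Z.of_nat X = ((5 * Z.of_nat N - 4) * (5 * Z.of_nat N - 4))%Z by rewrite /X /N; lia.
  have b2 : (b * b <= (5 * Z.of_nat N - 4) * (5 * Z.of_nat N - 4))%Z by have := Z.square_nonneg a; lia.
  have bb : (- (5 * Z.of_nat N - 4) <= b <= 5 * Z.of_nat N - 4)%Z.
    by move: b2; have : (0 < 5 * Z.of_nat N - 4)%Z by [rewrite /N; lia]; clear; move: (_ - _)%Z => Y; nia.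
  apply/mapP; exists (Z.to_nat (b / 5 + Z.of_nat N)); last by cbn [fst snd]; lia.
  by rewrite mem_index_iota; move: bb bE; cbn [fst snd]; move: (b / 5)%Z => q; lia.
have a2 : (- Z.of_nat X <= a <= Z.of_nat X)%Z by have := Z.square_nonneg b; clear -zX; nia.
rewrite mem_cat; apply/orP; cbn [fst snd]; move: a2 aE; move: (a / 5)%Z => q a2 aE.
have [q0|q0] := Z.le_gt_cases 0 q; [left|right]; apply/mapP.
  by exists (Z.to_nat q); rewrite ?mem_iota; lia.
by exists (Z.to_nat (- q - 1)); rewrite ?mem_iota; lia.
Qed.

Lemma sum_n_m_big (F : nat -> R) M : sum_n_m F 1 M = \big[Rplus/R0]_(1 <= k < M.+1) F k.
Proof.
elim: M => [|M IH]; first by rewrite sum_n_m_zero ?big_geq //; lia.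
by rewrite sum_n_Sm ?IH ?[RHS]big_nat_recr //; lia.
Qed.

Lemma sum_disk_list N' (N := N'.+1) (X := ((5 * N - 4) * (5 * N - 4))%N) :
  class_sum X = \big[Rplus/R0]_(n <- row_indices N)
    \big[Rplus/R0]_(m <- column_indices X.+1 | in_disk X n m) term m n.
Proof.
rewrite /class_sum -(sum_by_sqnorm (fun k => - ((-1) ^ k / INR k)) (disk_list_uniq N X)); last first.
  by move=> z; apply: mem_disk_list.
rewrite big_filter big_mkcond big_allpairs_dep; apply: eq_bigr => n _.
rewrite [RHS]big_mkcond; apply: eq_bigr => m _.
by rewrite term_sqnorm.
Qed.

(** There are 2N - 1 rows, each with error at most 2 / X, and X >= N^2. *)
Lemma row_sum_approx N' (N := N'.+1) (X := ((5 * N - 4) * (5 * N - 4))%N) :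
  Rabs (Zsum_sym (fun n => Zseries (fun m => term m n)) N - class_sum X) <= 4 / INR N.
Proof.
have X0 : (0 < X)%N by rewrite /X /N; lia.
rewrite sum_disk_list -/N -/X /Zsum_sym sum_n_m_big.
have -> : \big[Rplus/R0]_(1 <= k < (2 * N - 1).+1) Zseries (fun m => term m (Z.of_nat k - Z.of_nat N)) =
  \big[Rplus/R0]_(n <- row_indices N) Zseries (fun m => term m n).
  by rewrite big_map; congr bigop; congr index_iota; rewrite /N; lia.
pose E n := Zseries (fun m => term m n) - \big[Rplus/R0]_(m <- column_indices X.+1 | in_disk X n m) term m n.
have -> : \big[Rplus/R0]_(n <- row_indices N) Zseries (fun m => term m n) =
  \big[Rplus/R0]_(n <- row_indices N) E n +
  \big[Rplus/R0]_(n <- row_indices N) \big[Rplus/R0]_(m <- column_indices X.+1 | in_disk X n m) term m n.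
  by rewrite -big_split; apply: eq_bigr => n _; rewrite /E /=; ring.
rewrite (_ : forall x y : R, x + y - y = x); last by move=> x y; ring.
have := @sum_abs_le _ (row_indices N) xpredT E (fun _ => 2 / INR X) (fun n _ _ => row_truncation n X0).
move=> h; apply: Rle_trans h _.
rewrite sum_const_cond count_predT size_map size_iota.
have Np : 0 < INR N := INRS_gt0 N'.
have NX : INR N * INR N <= INR X by rewrite -mult_INR; apply: le_INR; rewrite /X /N; nia.
have cN : INR (2 * N - 1) <= 2 * INR N.
  by rewrite (_ : 2 = INR 2) // -mult_INR; apply: le_INR; lia.
have Xp : 0 < INR X by apply: lt_0_INR; apply/ltP.
have iX : / INR X <= / (INR N * INR N) by apply: Rinv_le_contravar => //; nra.
have -> : 4 / INR N = 2 * INR N * (2 * / (INR N * INR N)) by field; lra.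
apply: Rmult_le_compat => //; first exact: pos_INR.
  by apply: Rmult_le_pos; [lra|left; apply: Rinv_0_lt_compat].
by apply: Rmult_le_compat_l; [lra|].
Qed.

Theorem mainTheorem1 :
  (forall n : Z, ex_Zseries_abs (fun m : Z => term m n)) /\
  is_lim_seq
    (fun N : nat => Zsum_sym (fun n : Z => Zseries (fun m : Z => term m n)) N)
    (Finite
       (- (PI / (5 * sqrt 5)) * ln (sqrt 5 + 1 - sqrt (5 + 2 * sqrt 5))
        + PI / 25 * ln (11 + 5 * sqrt 5))).
Proof.
split; first exact: ex_Zseries_abs_term.
set S := _ + _; apply/is_lim_seq_incr_1.
(* The index is shifted so that N >= 1 and 5N - 4 does not truncate. These cutoffs are squares,
   hence a subsequence of those in [class_sum_limit]. *)
pose X N' := ((5 * N'.+1 - 4) * (5 * N'.+1 - 4))%N.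
have limX : is_lim_seq (fun N' => class_sum (X N')) S.
  apply: (is_lim_seq_subseq (fun Y => class_sum (Y * Y)) S (fun N' => 5 * N'.+1 - 4)%N) class_sum_limit.
  by apply: eventually_subseq => n; lia.
have lim4 : is_lim_seq (fun N' => 4 / INR N'.+1) 0.
  rewrite -(Rmult_0_r 4); apply: (is_lim_seq_scal_l _ 4 (Finite 0)).
  apply: (is_lim_seq_inv (fun k => INR k.+1) p_infty) => //.
  exact: (proj1 (is_lim_seq_incr_1 INR p_infty) is_lim_seq_INR).
apply: (is_lim_seq_le_le (fun N' => class_sum (X N') - 4 / INR N'.+1) _
                         (fun N' => class_sum (X N') + 4 / INR N'.+1)).
- by move=> N'; apply/Rabs_le_between'; exact: row_sum_approx.
- by rewrite -[S]Rminus_0_r; apply: is_lim_seq_minus'.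
by rewrite -[S]Rplus_0_r; apply: is_lim_seq_plus'.
Qed.
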